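(* Let $(\sigma,\eta,\rho)$ be Blaschke interpolation data with $n$ distinct interpolation nodes of which $k$ lie in $\mathbb T$. Suppose that the Blaschke interpolation problem with these data is solvable and that its solutions $\varphi$ have normalised linear fractional parametrization $$\varphi=\frac{a\zeta+b}{c\zeta+d}.$$ Suppose that there exist scalars $s_0,p_0\in\mathbb C$ such that $$|p_0|=1,\qquad s_0=\overline{s_0}\,p_0,\qquad |s_0|<2$$ and $$s_0a-2b+2p_0c-s_0d=0.$$ Then there exists a rational $\Gamma$-inner function $h=(s,p)$ such that (i) $h\in\mathcal R^{n,k}$; (ii) $h(\sigma_j)=(-2\eta_j,\eta_j^2)$ for $j=1,2,\dots,n$; (iii) $Ap(\sigma_j)=2\rho_j$ for $j=1,2,\dots,k$; (iv) for all but finitely many $\omega\in\mathbb T$, the function $\Phi_\omega\circ h$ is a solution of the Blaschke interpolation problem with data $(\sigma,\eta,\rho)$. An explicit function $h=(s,p)$ satisfying conditions (i)-(iv) is given by $$s=2\,\frac{2p_0c-s_0d}{s_0c-2d},\qquad p=\frac{-2p_0a+s_0b}{s_0c-2d}.$$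
   Context: $\mathbb D$ is the open unit disc, $\mathbb D^-$ its closure, $\mathbb T$ the unit circle. Phasar derivative: for differentiable $f:\mathbb T\to\mathbb C\setminus\{0\}$, $Af(e^{i\theta})=\frac{d}{d\theta}\arg f(e^{i\theta})$; for a rational inner function $\varphi$, $A\varphi(z)=z\varphi'(z)/\varphi(z)$ on $\mathbb T$. A rational inner function is the same as a finite Blaschke product. Blaschke interpolation data ($n\ge1$, $0\le k\le n$): a triple $(\sigma,\eta,\rho)$ where $\sigma=(\sigma_1,\dots,\sigma_n)$ are distinct points with $\sigma_j\in\mathbb T$ for $j\le k$ and $\sigma_j\in\mathbb D$ for $k<j\le n$; $\eta=(\eta_1,\dots,\eta_n)$ with $\eta_j\in\mathbb T$ for $j\le k$ and $\eta_j\in\mathbb D$ for $k<j\le n$; and $\rho=(\rho_1,\dots,\rho_k)$ with all $\rho_j>0$. Blaschke interpolation problem with data $(\sigma,\eta,\rho)$: find a rational inner function $\varphi$ of degree (exactly) $n$ such that $\varphi(\sigma_j)=\eta_j$ for $j=1,\dots,n$ and $A\varphi(\sigma_j)=\rho_j$ for $j=1,\dots,k$. Normalised linear fractional parametrization of the solutions: an expression $\varphi=\frac{a\zeta+b}{c\zeta+d}$ such that (1) $a,b,c,d$ are polynomials of degree at most $n$; (2) for all but at most $k$ values of $\zeta\in\mathbb T$ the function $\varphi(\lambda)=\frac{a(\lambda)\zeta+b(\lambda)}{c(\lambda)\zeta+d(\lambda)}$ is a solution of the problem; (3) for some $\tau\in\mathbb T\setminus\{\sigma_1,\dots,\sigma_k\}$,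 $a(\tau)=d(\tau)=1$ and $b(\tau)=c(\tau)=0$; (4) every solution has the form in (2) for some $\zeta\in\mathbb T$. $\Gamma=\{(z+w,zw):|z|\le1,|w|\le1\}\subset\mathbb C^2$, with distinguished boundary $b\Gamma=\{(z+w,zw):|z|=|w|=1\}$. A $\Gamma$-inner function is a holomorphic map $h:\mathbb D\to\Gamma$ whose boundary values at almost all points of $\mathbb T$ lie in $b\Gamma$; it is rational if its two components are. The royal variety is $\mathcal R=\{(2z,z^2):z\in\mathbb C\}$. Let $h=(s,p)$ be a rational $\Gamma$-inner function with $h(\mathbb D)\not\subset\mathcal R$. A royal node of $h$ is a point $\sigma\in\mathbb D^-$ with $h(\sigma)\in\mathcal R$, i.e. a zero of $s^2-4p$ in $\mathbb D^-$; if it is a zero of order $\ell$, its multiplicity as a royal node is $\ell$ if $\sigma\in\mathbb D$ and $\ell/2$ if $\sigma\in\mathbb T$. $\mathcal R^{n,k}$ is the set of rational $\Gamma$-inner functions $h$ whose royal nodes in $\mathbb D^-$ have multiplicities summing to $n$ and whose royal nodes in $\mathbb T$ have multiplicities summing to $k$. For $\omega\in\mathbb T$, $\Phi_\omega(s,p)=\frac{2\omega p-s}{2-\omega s}$. *)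

(* Defs.v *)
From HB Require Import structures.
From mathcomp Require Import all_boot all_order all_algebra.
From mathcomp Require Import complex.
From mathcomp Require Import all_classical all_reals all_analysis.

Set Implicit Arguments.
Unset Strict Implicit.
Unset Printing Implicit Defensive.

Import Order.TTheory GRing.Theory Num.Theory.
Import numFieldNormedType.Exports.

Local Open Scope classical_set_scope.
Local Open Scope ring_scope.
Local Open Scope complex_scope.

Section Disc.
Variable R : realType.
Local Notation C := R[i].

Definition disc : set C := [set z | `|z| < 1].
Definition closed_disc : set C := [set z | `|z| <= 1].
Definition circle : set C := [set z | `|z| = 1].

Definition expi (t : R) : C := cos t +i* sin t.

(* [R[i]^o] is [R[i]] seen as a normed space over itself, so this is complex
   differentiability. *)
Definition holomorphic_on_disc (f : C -> C) : Prop :=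
  forall z, disc z -> derivable (f : C^o -> C^o) z 1.

Definition radial_limit (f : C -> C) (t : R) (l : C) : Prop :=
  ((f (r%:C * expi t) : C^o) @[r --> (1 : R)^'-] --> (l : C^o)).

Definition inner (f : C -> C) : Prop :=
  [/\ holomorphic_on_disc f,
      forall z, disc z -> closed_disc (f z) &
      {ae lebesgue_measure, forall t : R,
        exists2 l, radial_limit f t l & circle l}].

(* [v] is the derivative at [t] of a local branch [g] of
   [u |-> arg (f (expi u))], where [z = expi t]. *)
Definition is_phasar_derivative (f : C -> C) (z : C) (v : R) : Prop :=
  exists (t : R) (g : R -> R),
    [/\ z = expi t,
        \forall u \near t, f (expi u) != 0 /\
          f (expi u) = `|f (expi u)| * expi (g u) &
        is_derive t 1 g v].

End Disc.

Section RationalFunctions.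
Variable R : realType.
Local Notation C := R[i].
Implicit Type f : {fraction {poly C}}.

(* Numerator and denominator in lowest terms; they are determined up to a
   common nonzero constant factor. *)
Definition rat_num f : {poly C} :=
  let r := fraction.frac (repr f) in r.1 %/ gcdp r.1 r.2.
Definition rat_den f : {poly C} :=
  let r := fraction.frac (repr f) in r.2 %/ gcdp r.1 r.2.

(* Removable singularities are removed; the value at a pole is 0. *)
Definition rat_eval f (z : C) : C := (rat_num f).[z] / (rat_den f).[z].

Definition rat_degree f : nat :=
  maxn (size (rat_num f)).-1 (size (rat_den f)).-1.

(* Meaningful when [f != 0] has no pole at [z]. *)
Definition zero_order f (z : C) : nat := mup z (rat_num f).

Definition constf (c : C) : {fraction {poly C}} := FracField.tofrac c%:P.

Definition rational_inner f : Prop := inner (rat_eval f).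

End RationalFunctions.

Section BlaschkeInterpolation.
Variable R : realType.
Local Notation C := R[i].

(* The nodes on the circle are those of index [j < k] (indices start at 0). *)
Record blaschke_data (n k : nat) := BlaschkeData {
  node : 'I_n -> C;
  target : 'I_n -> C;
  phasar : 'I_k -> R;
  blaschke_data_gt0 : (0 < n)%N;
  blaschke_data_le : (k <= n)%N;
  node_inj : injective node;
  node_circle : forall j : 'I_n, (j < k)%N ->
    circle (node j) /\ circle (target j);
  node_disc : forall j : 'I_n, (k <= j)%N ->
    disc (node j) /\ disc (target j);
  phasar_gt0 : forall j : 'I_k, 0 < phasar j
}.

Definition bnode n k (D : blaschke_data n k) (j : 'I_k) : C :=
  node D (widen_ord (blaschke_data_le D) j).

Definition blaschke_solution n k (D : blaschke_data n k)
    (phi : {fraction {poly C}}) : Prop :=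
  [/\ rational_inner phi,
      rat_degree phi = n,
      forall j : 'I_n, rat_eval phi (node D j) = target D j &
      forall j : 'I_k,
        is_phasar_derivative (rat_eval phi) (bnode D j) (phasar D j)].

Definition lin_frac (a b c d : {poly C}) (zeta : C) : {fraction {poly C}} :=
  FracField.tofrac (zeta *: a + b) / FracField.tofrac (zeta *: c + d).

Definition normalised_parametrization n k (D : blaschke_data n k)
    (a b c d : {poly C}) : Prop :=
  [/\ [/\ (size a <= n.+1)%N, (size b <= n.+1)%N,
          (size c <= n.+1)%N & (size d <= n.+1)%N],
      ([set zeta | circle zeta /\
        ~ blaschke_solution D (lin_frac a b c d zeta)] #<= `I_k)%card,
      exists tau, [/\ circle tau, forall j : 'I_k, tau != bnode D j,
        a.[tau] = 1 /\ d.[tau] = 1 & b.[tau] = 0 /\ c.[tau] = 0] &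
      forall phi, blaschke_solution D phi ->
        exists2 zeta, circle zeta & phi = lin_frac a b c d zeta].

End BlaschkeInterpolation.

Section GammaInner.
Variable R : realType.
Local Notation C := R[i].

Definition Gamma : set (C * C) :=
  [set x | exists z w, [/\ `|z| <= 1, `|w| <= 1 & x = (z + w, z * w)]].

Definition bGamma : set (C * C) :=
  [set x | exists z w, [/\ `|z| = 1, `|w| = 1 & x = (z + w, z * w)]].

Definition royal_variety : set (C * C) :=
  [set x | exists z, x = (2 * z, z ^+ 2)].

Definition Gamma_inner (h : C -> C * C) : Prop :=
  [/\ holomorphic_on_disc (fst \o h) /\ holomorphic_on_disc (snd \o h),
      forall z, disc z -> Gamma (h z) &
      {ae lebesgue_measure, forall t : R, exists l : C * C,
        [/\ radial_limit (fst \o h) t l.1, radial_limit (snd \o h) t l.2 &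
            bGamma l]}].

(* A pair [h = (s, p)] of rational functions, as a map into C^2. *)
Definition rat_map (h : {fraction {poly C}} * {fraction {poly C}}) (z : C) :
    C * C :=
  (rat_eval h.1 z, rat_eval h.2 z).

Definition rational_Gamma_inner (h : {fraction {poly C}} * {fraction {poly C}}) :
    Prop :=
  Gamma_inner (rat_map h).

Definition royal_nodes (h : {fraction {poly C}} * {fraction {poly C}}) : set C :=
  [set z | closed_disc z /\ royal_variety (rat_map h z)].

Definition royal_multiplicity (h : {fraction {poly C}} * {fraction {poly C}})
    (z : C) : rat :=
  let l := zero_order (h.1 ^+ 2 - 4 * h.2) z in
  if `|z| < 1 then l%:R else l%:R / 2.

(* The sums are over finite sets of nodes since [h] does not map the disc into
   the royal variety. *)
Definition royal_class (n k : nat) :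
    set ({fraction {poly C}} * {fraction {poly C}}) :=
  [set h | [/\ rational_Gamma_inner h,
      ~ (rat_map h @` @disc R `<=` royal_variety),
      \sum_(z \in royal_nodes h) royal_multiplicity h z = n%:R &
      \sum_(z \in royal_nodes h `&` @circle R) royal_multiplicity h z = k%:R]].

(* [Phi_omega \o h], as a rational function. *)
Definition Phi_comp (omega : C) (h : {fraction {poly C}} * {fraction {poly C}}) :
    {fraction {poly C}} :=
  (2 * constf omega * h.2 - h.1) / (2 - constf omega * h.1).

End GammaInner.

(* Main.v *)
Require Import Defs.
From HB Require Import structures.
From mathcomp Require Import all_boot all_order all_algebra.
From mathcomp Require Import generic_quotient complex.
From mathcomp Require Import all_classical all_reals all_analysis.
From mathcomp Require Import ring lra zify.

Import Order.TTheory GRing.Theory Num.Theory.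
Import numFieldNormedType.Exports.

Local Open Scope classical_set_scope.
Local Open Scope ring_scope.
Local Open Scope complex_scope.

(** Write a solution of parameter [zeta] as [(zeta a + b) / (zeta c + d)]. For
    all but finitely many unimodular [zeta] nothing cancels and the quotient is
    a finite Blaschke product of degree [n]; comparing it with its reversal for
    all these [zeta] shows that [c] and [d] are, up to one unimodular constant,
    the reversals of [b] and [a] ([param_reversal]). The interpolation and
    phasar conditions are affine in [zeta] as well, so they split into
    conditions on the coefficients ([param_interpolation], [param_phasar]):
    at a node [a = eta c] and [b = eta d], and on the circle the same holds for
    the derivatives up to a term in [rho].

    Let [W = a d - b c]. It vanishes at the nodes, doubly at those on the
    circle, and reversal maps it to a multiple of itself. As its degree is at
    most [2 n], these zeros and the reflections of those in the open disc are
    all its zeros ([det_factor]). Moreover [|zeta a + b| <= |zeta c + d|] on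
    the closed disc for every unimodular [zeta], so [|c| = |d|] is possible
    only where [W = 0]; since [c = 0] and [d = 1] at [tau], continuity along
    segments from [tau] gives [|c| <= |d|] on the closed disc ([param_dominated]).

    Put [S = 2 p0 c - s0 d], [P = - 2 p0 a + s0 b] and [E = s0 c - 2 d], so that
    [s = 2 S / E] and [p = P / E]. The conditions on [s0] and [p0] give
    [|E|^2 - |S|^2 = (4 - |s0|^2) (|d|^2 - |c|^2)], hence [E] has no zero in the
    closed disc and [|s| <= 2] there. For unimodular [omega] the function
    [Phi_omega \o h] is the member of the pencil of parameter
    [Phi_omega (s0, p0)] ([Phi_comp_pencil]), so it is a solution for
    all but finitely many [omega]; and [|2 omega p - s|] is at most
    [|2 - omega s|], which together with [|s| <= 2] puts [(s, p)] in [Gamma]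
    ([Gamma_of_pencil]). On the circle the reversal symmetry gives [|p| = 1] and
    [s = s^* p], the conditions for the distinguished boundary. Finally, the relation between the coefficients
    turns [s ^ 2 - 4 p] into a nonzero constant times [W / E ^ 2]
    ([royal_discriminant]), so the royal nodes in the closed disc are the
    interpolation nodes, each of multiplicity one. The values of [h] and the
    phasar derivatives of [p] at the nodes come from inserting the conditions
    on the coefficients into [S], [P] and [E] ([phasar_doubling]). *)

Local Notation re := (@complex.Re _).
Local Notation im := (@complex.Im _).

(** * Rational functions in lowest terms *)

Section LowestTerms.
Local Open Scope ring_scope.
Context {R : realType}.
Local Notation C := R[i].
Implicit Types (f : {fraction {poly C}}) (N D : {poly C}).

Lemma fraction_repr (T : idomainType) (f : {fraction T}) :
  f * FracField.tofrac (fraction.frac (repr f)).2 =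
  FracField.tofrac (fraction.frac (repr f)).1.
Proof.
rewrite -[f in f * _]reprK; unlock FracField.tofrac; rewrite -[LHS]FracField.pi_mul.
apply/eqmodP; rewrite /= FracField.equivfE /FracField.mulf.
by rewrite !numden_Ratio ?oner_eq0 ?mulr1 ?mul1r ?denom_ratioP // mulrC.
Qed.

(** [rat_num] and [rat_den] come from an unspecified representative of the
    class; cross-multiplication with any other presentation and Gauss's lemma
    show that they divide it with the same quotient. *)
Lemma rat_numdenP N D : D != 0 ->
  let f := FracField.tofrac N / FracField.tofrac D in
  exists h : {poly C}, [/\ h != 0, N = h * rat_num f, D = h * rat_den f &
    coprimep (rat_num f) (rat_den f)].
Proof.
move=> D0 f.
set r := fraction.frac (repr f).
have r20 : r.2 != 0 by exact: denom_ratioP.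
have fE : f * FracField.tofrac r.2 = FracField.tofrac r.1.
  exact: fraction_repr.
have FD0 : FracField.tofrac D != 0 by rewrite tofrac_eq0.
have cross : r.1 * D = r.2 * N.
  apply/eqP; rewrite -tofrac_eq !tofracM -fE /f mulrAC divfK //.
  by rewrite mulrC.
have g0 : gcdp r.1 r.2 != 0 by rewrite gcdp_eq0 negb_and r20 orbT.
have e1 : rat_num f * gcdp r.1 r.2 = r.1 by rewrite divpK ?dvdp_gcdl.
have e2 : rat_den f * gcdp r.1 r.2 = r.2 by rewrite divpK ?dvdp_gcdr.
have cop : coprimep (rat_num f) (rat_den f).
  by apply: coprimep_div_gcd; rewrite r20 orbT.
have cr : rat_num f * D = rat_den f * N.
  by apply: (mulIf g0); rewrite mulrAC e1 cross [RHS]mulrAC e2.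
have dd : rat_den f %| D.
  rewrite -(Gauss_dvdpr _ (q := rat_num f)) 1?coprimep_sym //.
  by rewrite cr dvdp_mulr.
have den0 : rat_den f != 0 by apply: contra_neq r20 => e; rewrite -e2 e mul0r.
exists (D %/ rat_den f).
have eD : D = D %/ rat_den f * rat_den f by rewrite divpK.
split=> //.
- by apply: contra_neq D0 => e; rewrite eD e mul0r.
- apply: (mulfI den0); rewrite -cr {1}eD; ring.
Qed.

Lemma rat_evalE {N D z} : D.[z] != 0 ->
  rat_eval (FracField.tofrac N / FracField.tofrac D) z = N.[z] / D.[z].
Proof.
move=> Dz; have D0 : D != 0 by apply: contra_neq Dz => ->; rewrite horner0.
rewrite /rat_eval; have := rat_numdenP N D D0; set f := _ / _ => - [h [h0 eN eD _]].
have hz : h.[z] != 0 by apply: contra_neq Dz; rewrite eD hornerM => ->; rewrite mul0r.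
clearbody f; rewrite eN eD !hornerM invfM mulrACA divff ?mul1r //.
Qed.

Lemma zero_orderE {N D z} : D.[z] != 0 ->
  zero_order (FracField.tofrac N / FracField.tofrac D) z = mup z N.
Proof.
move=> Dz; have D0 : D != 0 by apply: contra_neq Dz => ->; rewrite horner0.
rewrite /zero_order; have := rat_numdenP N D D0; set f := _ / _ => - [h [h0 eN eD _]].
have hz : h.[z] != 0 by apply: contra_neq Dz; rewrite eD hornerM => ->; rewrite mul0r.
by clearbody f; rewrite eN mupMr.
Qed.

(** Cancelling a common factor lowers both degrees, so none is left when the
    degree is the largest possible. *)
Lemma rat_degree_full {N D n} : (0 < n)%N ->
  (size N <= n.+1)%N -> (size D <= n.+1)%N ->
  rat_degree (FracField.tofrac N / FracField.tofrac D) = n ->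
  [/\ D != 0, coprimep N D & maxn (size N) (size D) = n.+1].
Proof.
move=> n0 sN sD; rewrite /rat_degree.
set f := _ / _ => degf.
have [D0|D0] := eqVneq D 0.
  have f0 : f = FracField.tofrac 0 / FracField.tofrac 1.
    by rewrite /f D0 tofrac0 invr0 mulr0 mul0r.
  have [h [h0 eN eD _]] := rat_numdenP 0 1 (oner_neq0 _).
  move: degf; rewrite f0.
  have -> : rat_num (FracField.tofrac 0 / FracField.tofrac 1) = 0 :> {poly C}.
    by move/esym/eqP: eN; rewrite mulf_eq0 (negPf h0) /= => /eqP.
  have : size (rat_den (FracField.tofrac 0 / FracField.tofrac 1) : {poly C}) = 1%N.
    apply/eqP; rewrite size_poly_eq1; apply: (@dvdp_eqp1 _ _ 1); last exact: eqpxx.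
    by apply/dvdpP; exists h.
  by move=> ->; rewrite size_poly0 /= => e; rewrite -e in n0.
have [h [h0 eN eD cop]] := rat_numdenP N D D0.
rewrite -/f in eN eD cop.
have den0 : rat_den f != 0 by apply: contra_neq D0 => e; rewrite eD e mulr0.
have sh : size h = 1%N.
  have h1 : (0 < size h)%N by rewrite size_poly_gt0.
  have sD' : size D = (size h + size (rat_den f)).-1 by rewrite {1}eD size_mul.
  have sd1 : (0 < size (rat_den f))%N by rewrite size_poly_gt0.
  have [nle|nle] := leqP (size (rat_num f)).-1 (size (rat_den f)).-1.
    move: degf; rewrite (maxn_idPr nle) => e; apply/eqP.
    by rewrite eqn_leq h1 andbT; move: sD' sD sd1 e h1 => -> ; clear; lia.
  have num0 : rat_num f != 0.
    by rewrite -size_poly_gt0; move: nle; case: (size (rat_num f)).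
  have sN' : size N = (size h + size (rat_num f)).-1 by rewrite {1}eN size_mul.
  move: degf; rewrite (maxn_idPl (ltnW nle)) => e; apply/eqP.
  by rewrite eqn_leq h1 andbT; move: sN' sN nle e h1 => -> ; clear; lia.
have [x x0 eh] : exists2 x : C, x != 0 & h = x%:P.
  by move/eqP: sh => /size_poly1P.
split=> //.
  by rewrite eN eD eh !mul_polyC coprimepZl // coprimepZr.
rewrite eN eD eh !mul_polyC !size_scale //.
have sd1 : (0 < size (rat_den f))%N by rewrite size_poly_gt0.
by move: degf n0 sd1; rewrite !maxnE; move: (size _) (size _) => u v; clear; lia.
Qed.

End LowestTerms.

(** * Differentiable curves in the complex plane *)

Section Curves.
Local Open Scope ring_scope.
Context {R : realType}.
Local Notation C := R[i].
Implicit Types (f g : R -> C) (p q : {poly C}) (t : R).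

(** Differentiability of a curve in the plane, read coordinatewise: this keeps
    real and complex scalars apart. *)
Definition curve_derive f t (l : C) : Prop :=
  is_derive t 1 (fun u => re (f u)) (re l) /\
  is_derive t 1 (fun u => im (f u)) (im l).

Definition normsq (z : C) : R := re z ^+ 2 + im z ^+ 2.

Lemma normsqE z : (normsq z)%:C = `|z| ^+ 2.
Proof. exact: add_Re2_Im2. Qed.

Lemma normsq_le z w : (normsq z <= normsq w) = (`|z| <= `|w|).
Proof. by rewrite -lecR !normsqE ler_sqr ?nnegrE. Qed.

Lemma reM (z w : C) : re (z * w) = re z * re w - im z * im w.
Proof. by case: z w => [a b] [c d]. Qed.

Lemma imM (z w : C) : im (z * w) = re z * im w + im z * re w.
Proof. by case: z w => [a b] [c d]. Qed.

Lemma reD (z w : C) : re (z + w) = re z + re w.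
Proof. by case: z w => [a b] [c d]. Qed.

Lemma imD (z w : C) : im (z + w) = im z + im w.
Proof. by case: z w => [a b] [c d]. Qed.

Lemma complex_ext (z w : C) : re z = re w -> im z = im w -> z = w.
Proof. by case: z w => [a b] [c d] /= -> ->. Qed.

Lemma curve_unique {f t} {l m : C} : curve_derive f t l -> curve_derive f t m -> l = m.
Proof.
by move=> [[_ a] [_ b]] [[_ a'] [_ b']]; apply: complex_ext;
  rewrite -?a -?a' -?b -?b'.
Qed.

Lemma curve_near {f g t} {l : C} : (\near t, f t = g t) ->
  curve_derive f t l -> curve_derive g t l.
Proof.
move=> fg [a b]; split.
  by apply: near_eq_is_derive a; near do apply/(congr1 (@complex.Re R)).
by apply: near_eq_is_derive b; near do apply/(congr1 (@complex.Im R)).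
Unshelve. all: by end_near. Qed.

Lemma is_derive_ext {h k : R -> R} {t} {l m : R} : is_derive t 1 h l ->
  (forall u, k u = h u) -> m = l -> is_derive t 1 k m.
Proof. by move=> d e ->; have -> : k = h by apply/funext. Qed.

Lemma curve_cst c t : curve_derive (fun=> c) t 0.
Proof. by split; exact: is_derive_cst. Qed.

Lemma curveD {f g t} {l m : C} : curve_derive f t l -> curve_derive g t m ->
  curve_derive (fun u => f u + g u) t (l + m).
Proof.
move=> [a b] [a' b']; split.
  by apply: (is_derive_ext (is_deriveD a a')) => [u|]; rewrite reD.
by apply: (is_derive_ext (is_deriveD b b')) => [u|]; rewrite imD.
Qed.

Lemma curveM {f g t} {l m : C} : curve_derive f t l -> curve_derive g t m ->
  curve_derive (fun u => f u * g u) t (l * g t + f t * m).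
Proof.
move=> [a b] [a' b']; split.
  apply: (is_derive_ext
    (is_deriveB (is_deriveM a a') (is_deriveM b b'))) => [u|].
    by rewrite reM.
  rewrite reD !reM /GRing.scale /=; ring.
apply: (is_derive_ext
  (is_deriveD (is_deriveM a b') (is_deriveM b a'))) => [u|].
  by rewrite imM.
rewrite imD !imM /GRing.scale /=; ring.
Qed.

Lemma curve_horner p {f t} {l : C} : curve_derive f t l ->
  curve_derive (fun u => p.[f u]) t (p^`().[f t] * l).
Proof.
move=> df; elim/poly_ind: p => [|p c IHp].
  rewrite deriv0 horner0 mul0r.
  have -> : (fun u => 0.[f u]) = (fun=> 0 : C).
    by apply/funext => u; rewrite horner0.
  exact: curve_cst.
have -> : (fun u => (p * 'X + c%:P).[f u]) = (fun u => p.[f u] * f u + c).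
  by apply/funext => u; rewrite !hornerE.
have := curveD (curveM IHp df) (curve_cst c t).
by congr curve_derive; rewrite derivMXaddC !hornerE; ring.
Qed.

Lemma curve_inv {f t} {l : C} : f t != 0 -> curve_derive f t l ->
  curve_derive (fun u => (f u)^-1) t (- l / f t ^+ 2).
Proof.
move=> ft0 [a b].
have n0 : normsq (f t) != 0.
  by apply: contra_neq ft0 => e; apply/eqP; rewrite -normr_eq0 -sqrf_eq0 -normsqE e.
have dn := is_deriveV (f := fun u => normsq (f u)) n0
  (is_deriveD (is_deriveM a a) (is_deriveM b b)).
have E u : (f u)^-1 = (re (f u) * (normsq (f u))^-1) +i* (- im (f u) * (normsq (f u))^-1).
  by rewrite /normsq; case: (f u) => x y; rewrite mulNr.
set x := re (f t) in a b dn n0 *; set y := im (f t) in a b dn n0 *.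
have E2 : - l / f t ^+ 2 =
    (x * (- normsq (f t) ^- 2 * (x * re l + x * re l + (y * im l + y * im l)))
       + (normsq (f t))^-1 * re l)
 +i* (- y * (- normsq (f t) ^- 2 * (x * re l + x * re l + (y * im l + y * im l)))
       + (normsq (f t))^-1 * - im l).
  apply: (canLR (mulfK _)); first by rewrite sqrf_eq0.
  move: n0; rewrite /normsq -/x -/y => n0.
  by apply: complex_ext; rewrite expr2 !(reM, imM) -/x -/y; case: (l) => u v /=;
    field.
split.
  apply: (is_derive_ext (is_deriveM a dn)) => [u|]; first by rewrite E.
  by rewrite E2.
apply: (is_derive_ext (is_deriveM (is_deriveN b) dn)) => [u|]; first by rewrite E.
by rewrite E2.
Qed.

Lemma curve_ratio p q {f t} {l : C} : curve_derive f t l -> q.[f t] != 0 ->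
  curve_derive (fun u => p.[f u] / q.[f u]) t
    ((p^`().[f t] * q.[f t] - p.[f t] * q^`().[f t]) / q.[f t] ^+ 2 * l).
Proof.
move=> df q0; have dp := curve_horner p df; have dq := curve_horner q df.
have := curveM dp (curve_inv q0 dq).
by congr curve_derive; field.
Qed.

Lemma curve_affine a b t : curve_derive (fun u => a + u%:C * b) t b.
Proof.
have H : curve_derive (fun u => u%:C) t 1.
  by split => /=; [exact: is_derive_id|exact: is_derive_cst].
have := curveD (curve_cst a t) (curveM H (curve_cst b t)).
by congr curve_derive; ring.
Qed.

Lemma curve_expi t : curve_derive (@expi R) t ('i%C * expi t).
Proof.
split; rewrite /expi /=.
  by apply: (is_derive_ext (is_derive_cos t)) => //=; rewrite mul0r mul1r sub0r.
by apply: (is_derive_ext (is_derive_sin t)) => //=; rewrite mul0r mul1r add0r.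
Qed.

Lemma curve_cvg_re {f t} {l : C} : curve_derive f t l -> re (f u) @[u --> t] --> re (f t).
Proof.
move=> [[a _] _]; apply: differentiable_continuous; exact/derivable1_diffP.
Qed.

Lemma curve_cvg_im {f t} {l : C} : curve_derive f t l -> im (f u) @[u --> t] --> im (f t).
Proof.
move=> [_ [a _]]; apply: differentiable_continuous; exact/derivable1_diffP.
Qed.

Lemma curve_cvg_normsq {f t} {l : C} : curve_derive f t l ->
  normsq (f u) @[u --> t] --> normsq (f t).
Proof.
move=> df; have a := curve_cvg_re df; have b := curve_cvg_im df.
by apply: cvgD; apply: cvgM.
Qed.

Lemma normc_real (x : R) : `|x%:C| = `|x|%:C.
Proof. by rewrite normc_def /= expr0n addr0 sqrtr_sqr. Qed.

Lemma normc_le_re_im (z : C) : `|z| <= (`|re z| + `|im z|)%:C.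
Proof.
rewrite [in leLHS](complexE z) (le_trans (ler_normD _ _)) // normrM !normc_real.
have -> : `|'i%C : C| = 1.
  by rewrite normc_def /= expr0n expr1n add0r sqrtr1.
by rewrite mul1r rmorphD.
Qed.

Lemma cvg_complex (T : Type) (F : set_system T) (FF : Filter F) (f : T -> C) (l : C) :
  re (f u) @[u --> F] --> re l -> im (f u) @[u --> F] --> im l ->
  (f u : C^o) @[u --> F] --> (l : C^o).
Proof.
move=> a b; apply/cvgrPdist_lt => e e0.
have eE : e = (re e)%:C by rewrite RRe_real // gtr0_real.
have e20 : 0 < re e / 2 by rewrite divr_gt0 // -ltcR -eE.
have /cvgrPdist_lt/(_ _ e20) a' := a.
have /cvgrPdist_lt/(_ _ e20) b' := b.
near=> x.
apply: (le_lt_trans (normc_le_re_im _)); rewrite [ltRHS]eE ltcR (splitr (re e)).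
have -> : re (l - f x) = re l - re (f x) by case: (l) (f x) => [? ?] [].
have -> : im (l - f x) = im l - im (f x) by case: (l) (f x) => [? ?] [].
by apply: ltrD; near: x.
Unshelve. all: by end_near. Qed.

Lemma curve_cvg {f t} {l : C} : curve_derive f t l ->
  (f u : C^o) @[u --> t] --> (f t : C^o).
Proof.
by move=> df; apply: cvg_complex; [apply: curve_cvg_re df|apply: curve_cvg_im df].
Qed.

Lemma curve_neq {f t} {l w : C} : curve_derive f t l -> f t != w ->
  \forall u \near t, f u != w.
Proof.
move=> df ne; have dg := curveD df (curve_cst (- w) t).
have := curve_cvg_normsq dg; rewrite /=.
have n0 : 0 < normsq (f t - w).
  by rewrite -ltcR normsqE exprn_gt0 // normr_gt0 subr_eq0.
move/cvgr_gt => /(_ _ n0); apply: filterS => u; apply: contraTneq => ->.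
by rewrite subrr /normsq /= expr0n addr0 ltxx.
Qed.

(** Bounds that are known off a finite set reach the exceptional points by
    approaching them along a curve that avoids the set. *)
Lemma curve_norm_le {f g t} {l m : C} : curve_derive f t l -> curve_derive g t m ->
  (\forall u \near t^'+, `|f u| <= `|g u|) -> `|f t| <= `|g t|.
Proof.
move=> df dg H; rewrite -normsq_le -subr_ge0.
have : normsq (g u) - normsq (f u) @[u --> t^'+] --> normsq (g t) - normsq (f t).
  by apply: cvg_at_right_filter; apply: cvgB;
    [apply: curve_cvg_normsq dg|apply: curve_cvg_normsq df].
move=> c; rewrite -(cvg_lim (@Rhausdorff R) c).
apply: limr_ge; first exact: (cvgP _ c).
by apply: filterS H => u; rewrite subr_ge0 normsq_le.
Qed.

Lemma near_notin (T : eqType) (F : set_system R) (FF : Filter F) (f : R -> T) (s : seq T) :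
  (forall x, x \in s -> \forall u \near F, f u != x) ->
  \forall u \near F, f u \notin s.
Proof.
elim: s => [|x s IHs] H; first by apply: nearW => u; rewrite in_nil.
have Hx := H x (mem_head _ _).
have Hs := IHs (fun y ys => H y (mem_behead (s := x :: s) ys)).
near=> u; rewrite in_cons negb_or; apply/andP; split; near: u => //.
Unshelve. all: by end_near. Qed.

Lemma expi0 : expi (0 : R) = 1.
Proof. by rewrite /expi cos0 sin0. Qed.

Lemma normsq_expi t : normsq (expi t) = 1.
Proof. by rewrite /normsq /= cos2Dsin2. Qed.

Lemma norm_normsq (z : C) : normsq z = 1 -> `|z| = 1.
Proof.
by move=> e; apply/eqP; rewrite -(@eqrXn2 _ 2) ?ler01 // -normsqE e expr1n.
Qed.

Lemma norm_expi t : `|expi t| = 1.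
Proof. exact/norm_normsq/normsq_expi. Qed.

Lemma expiD t u : expi (t + u) = expi t * expi u :> C.
Proof.
by apply: complex_ext; rewrite ?reM ?imM /= ?cosD ?sinD // addrC.
Qed.

Lemma circle_expi {z : C} : circle z -> exists t, z = expi t.
Proof.
rewrite /circle /= => z1.
have n1 : re z ^+ 2 + im z ^+ 2 = 1.
  by apply: complexI; rewrite add_Re2_Im2 z1 expr1n.
have rz : -1 <= re z <= 1.
  rewrite -ler_norml -(@ler_pXn2r _ 2) ?nnegrE // expr1n real_normK ?num_real //.
  by rewrite -n1 lerDl sqr_ge0.
have sz : Num.sqrt (1 - re z ^+ 2) = `|im z|.
  by rewrite -n1 addrC addKr sqrtr_sqr.
have [h|h] := leP 0 (im z).
  exists (acos (re z)); apply: complex_ext; rewrite /= ?acosK ?in_itv //.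
  by rewrite sin_acos // sz ger0_norm.
exists (- acos (re z)); apply: complex_ext; rewrite /= ?cosN ?sinN ?acosK ?in_itv //.
by rewrite sin_acos // sz ltr0_norm // opprK.
Qed.

(** Rotating an exceptional parameter slightly reaches parameters that are not
    exceptional. *)
Lemma near_rotation_notin {z : C} (s : seq C) : circle z ->
  \forall u \near (0 : R)^'+, z * expi u \notin s.
Proof.
rewrite /circle /= => z1; apply: near_notin => x _.
have [<-|zx] := eqVneq z x; last first.
  have dc := curveM (curve_cst z 0) (curve_expi 0).
  have : z * expi 0 != x by rewrite expi0 mulr1.
  move=> /(curve_neq dc) H; exact: (cvg_at_right_filter (f := id) cvg_id).
near=> u; apply/eqP => /esym/eqP; rewrite -{1}[z]mulr1.
have z0 : z != 0 by rewrite -normr_eq0 z1 oner_eq0.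
rewrite (inj_eq (mulfI z0)) => /eqP/(congr1 (@complex.Im R)) /=.
have : 0 < sin u.
  apply: sin_gt0_pi; apply/andP; split; near: u.
    exact: nbhs_right_gt.
  by apply: nbhs_right_lt; exact: pi_gt0.
by move=> + e; rewrite -e ltxx.
Unshelve. all: by end_near. Qed.

Lemma circle_avoid (s : seq C) : exists2 z, circle z & z \notin s.
Proof.
have c1 : circle (1 : C) by rewrite /circle /= normr1.
near (0 : R)^'+ => u; exists (1 * expi u).
  by rewrite /circle /= mul1r norm_expi.
by near: u; exact: near_rotation_notin.
Unshelve. all: by end_near. Qed.

End Curves.

(** * Polynomials on the unit circle *)

Section Reversal.
Local Open Scope ring_scope.
Context {R : realType}.
Local Notation C := R[i].
Implicit Types (p q N D : {poly C}) (z : C).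

Lemma conjXn (F : numClosedFieldType) (x : F) n : (x ^+ n)^* = x^* ^+ n.
Proof. exact: rmorphXn. Qed.

Lemma conjM (F : numClosedFieldType) (x y : F) : (x * y)^* = x^* * y^*.
Proof. exact: rmorphM. Qed.

Lemma poly_roots {p} : p != 0 -> exists s : seq C, forall z, root p z = (z \in s).
Proof.
move=> p0; have [s ps] := closed_field_poly_normal p; exists s => z.
rewrite ps rootZ ?lead_coef_eq0 //.
by rewrite root_prod_XsubC.
Qed.

Lemma circle_poly_eq {p q} (s : seq C) :
  (forall z, circle z -> z \notin s -> p.[z] = q.[z]) -> p = q.
Proof.
move=> H; apply/eqP; rewrite -subr_eq0; apply: contraT => pq0.
have [r rP] := poly_roots pq0.
have [z cz] := circle_avoid (s ++ r); rewrite mem_cat negb_or -rP => /andP[zs].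
by rewrite rootE !hornerE H // subrr eqxx.
Qed.

Lemma circle_neq0 {z} : circle z -> z != 0.
Proof. by rewrite /circle /= => e; rewrite -normr_eq0 e oner_eq0. Qed.

Lemma circle_conj {z} : circle z -> z^* = z^-1.
Proof. by rewrite /circle /= => z1; rewrite invC_norm z1 expr1n invr1 mul1r. Qed.

(** The polynomial [z ^ n * (p (1 / z^* ))^*], that is [z ^ n * (p z)^*] on the
    circle; [n] is a formal degree, which makes it multiplicative. *)
Definition revp (n : nat) p : {poly C} := \poly_(i < n.+1) (p`_(n - i))^*.

Lemma size_revp n p : (size (revp n p) <= n.+1)%N.
Proof. exact: size_poly. Qed.

Lemma horner_revp {n p z} : (size p <= n.+1)%N -> circle z ->
  (revp n p).[z] = z ^+ n * (p.[z])^*.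
Proof.
move=> sp cz; rewrite horner_poly (horner_coef_wide _ sp) rmorph_sum mulr_sumr.
rewrite (reindex_inj rev_ord_inj) /=; apply: eq_bigr => i _.
have le_in : (i <= n)%N by rewrite -ltnS.
rewrite subSS (subKn le_in) conjM mulrCA; congr (_ * _).
rewrite conjXn (circle_conj cz) exprVn -expfB_cond ?(negPf (circle_neq0 cz)) //.
Qed.

Lemma revpK {n p} : (size p <= n.+1)%N -> revp n (revp n p) = p.
Proof.
move=> sp; apply: (circle_poly_eq [::]) => z cz _.
rewrite !horner_revp ?size_revp // conjM conjCK conjXn (circle_conj cz).
by rewrite exprVn mulVKf // expf_neq0 ?circle_neq0.
Qed.

Lemma revpM m n p q : (size p <= m.+1)%N -> (size q <= n.+1)%N ->
  revp (m + n) (p * q) = revp m p * revp n q.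
Proof.
move=> sp sq; apply: (circle_poly_eq [::]) => z cz _.
have spq : (size (p * q)%R <= (m + n).+1)%N.
  by apply: leq_trans (size_polyMleq _ _) _; move: sp sq; clear; lia.
rewrite hornerM !horner_revp // hornerM conjM exprD; ring.
Qed.

Lemma revp_eq0 {n p} : (size p <= n.+1)%N -> (revp n p == 0) = (p == 0).
Proof.
move=> sp; apply/eqP/eqP => [e|->]; last first.
  by apply/polyP => i; rewrite coef_poly !coef0 conjC0 if_same.
rewrite -(revpK sp) e.
by apply/polyP => i; rewrite coef_poly !coef0 conjC0 if_same.
Qed.

(** The hypothesis says that [N / D] is unimodular on the circle. As [N] and
    [D] are coprime, [N] divides [revp n D], and the degrees leave only a
    constant quotient: [N / D] has the form [revp n D / D] of a finite Blaschke
    product. *)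
Lemma unimodular_ratio {n N D} : (size N <= n.+1)%N -> (size D <= n.+1)%N ->
  coprimep N D -> maxn (size N) (size D) = n.+1 ->
  N * revp n N = D * revp n D ->
  exists q : C, revp n D = q *: N.
Proof.
move=> sN sD cop mx e.
have /dvdpP[q eq] : N %| revp n D.
  by rewrite -(Gauss_dvdpr _ cop) -e dvdp_mulr.
have [N0|N0] := eqVneq N 0.
  exists 0; rewrite scale0r.
  by rewrite eq N0 mulr0.
have eN : revp n N = D * q.
  by apply: (mulfI N0); rewrite e eq; ring.
have sq : (size q <= 1)%N.
  have [q0|q0] := eqVneq q 0; first by rewrite q0 size_poly0.
  have rD0 : revp n D != 0 by rewrite eq mulf_neq0.
  have D0 : D != 0 by rewrite -(revp_eq0 sD).
  have := size_revp n N; have := size_revp n D.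
  rewrite eN eq !size_mul //.
  have : (0 < size N)%N by rewrite size_poly_gt0.
  have : (0 < size D)%N by rewrite size_poly_gt0.
  by move: mx; rewrite maxnE; move: (size N) (size D) (size q) => u v w; clear; lia.
by exists q`_0; rewrite eq [q in LHS](size1_polyC sq) mul_polyC.
Qed.

End Reversal.

(** * Rational inner functions *)

Section InnerRatio.
Local Open Scope ring_scope.
Context {R : realType}.
Local Notation C := R[i].
Implicit Types (N D p q m : {poly C}) (z : C).

(** A segment from a point of the closed disc into the open disc meets the
    zeros of [m] finitely often. *)
Lemma disc_dense_norm_le m p q : m != 0 ->
  (forall z, disc z -> m.[z] != 0 -> `|p.[z]| <= `|q.[z]|) ->
  forall z, closed_disc z -> `|p.[z]| <= `|q.[z]|.
Proof.
rewrite /disc /closed_disc /= => m0 H z z1.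
have [v vz v1] : exists2 v : C, v != z & `|v| < 1.
  have [->|z0] := eqVneq z 0; last by exists 0; rewrite 1?eq_sym ?normr0.
  exists 2^-1; first by rewrite invr_eq0 pnatr_eq0.
  by rewrite normfV normr_nat invf_lt1 ?ltr0n ?ltr1n.
have dc t := curve_affine z (v - z) t.
have c0 : z + (0 : R)%:C * (v - z) = z by rewrite mul0r addr0.
have := curve_norm_le (curve_horner p (dc 0)) (curve_horner q (dc 0)).
rewrite c0; apply.
have [s sP] := poly_roots m0.
have ns : \forall u \near (0 : R)^'+, z + u%:C * (v - z) \notin s.
  apply: near_notin => x _.
  have [<-|xz] := eqVneq z x.
    near=> u; rewrite -subr_eq0 addrAC subrr add0r mulf_neq0 ?subr_eq0 //.
    by rewrite lt0r_neq0 // (ltcR 0 u); near: u; exact: nbhs_right_gt.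
  have : z + (0 : R)%:C * (v - z) != x by rewrite c0.
  by move=> /(curve_neq (dc 0)) ?; exact: (cvg_at_right_filter (f := id) cvg_id).
near=> u; apply: H; last by rewrite -rootE sP; near: u.
have u0 : 0 < u by near: u; exact: nbhs_right_gt.
have u1 : u < 1 by near: u; exact: nbhs_right_lt.
have -> : z + u%:C * (v - z) = (1 - u%:C) * z + u%:C * v by ring.
apply: (le_lt_trans (ler_normD _ _)); rewrite !normrM.
have -> : `|u%:C| = u%:C :> C by rewrite normc_real gtr0_norm.
have -> : `|1 - u%:C| = 1 - u%:C :> C.
  by rewrite -(rmorph1 (real_complex R)) -rmorphB normc_real gtr0_norm ?subr_gt0.
have uC0 : 0 < u%:C :> C by rewrite ltcR.
have uC1 : 0 <= 1 - u%:C :> C by rewrite subr_ge0 lecR ltW.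
rewrite -[ltRHS](subrK u%:C); apply: ler_ltD.
  by rewrite ler_piMr.
by rewrite gtr_pMr.
Unshelve. all: by end_near. Qed.

(** On [[0, 1]] the map [expi] is injective, so the angles in [[0, 1]] that it
    sends into a finite set form a null set. *)
Lemma ae_circle_avoid (P : R -> Prop) (s : seq C) :
  {ae lebesgue_measure, forall t : R, P t} ->
  exists2 t, P t & expi t \notin s.
Proof.
move=> aeP; apply: contrapT => nex.
pose T := [set t : R | 0 <= t <= 1 /\ expi t \in s].
have Tfin : finite_set T.
  have injT : set_inj T (@expi R).
    move=> x y; rewrite !inE /T /= => -[/andP[x0 x1] _] [/andP[y0 y1] _].
    have pi1 : 1 <= pi :> R by have := pi_ge2 R; lra.
    move=> /(congr1 (@complex.Re R)) /=; apply: cos_inj;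
      by rewrite in_itv /=; apply/andP; split; lra.
  rewrite -(eq_finite_set (inj_card_eq injT)).
  apply: (sub_finite_set (B := [set` s])); last exact: finite_seq.
  by move=> _ [t [_ ts] <-].
have T0 : lebesgue_measure.-negligible T.
  by apply/negligibleP; [exact: countable_measurable (finite_set_countable Tfin)
    |exact: countable_lebesgue_measure0 (finite_set_countable Tfin)].
have : lebesgue_measure.-negligible `[0 : R, 1]%classic.
  apply: negligibleS (negligibleU aeP T0) => t; rewrite /= in_itv /= => t01.
  have [Pt|nPt] := pselect (P t); last by left.
  right; split=> //; apply: contrapT => /negP ts.
  by apply: nex; exists t.
move=> neg.
have : lebesgue_measure (`[0 : R, 1]%classic : set R) = 0%E.
  by apply: measure_negligible => //; exact: measurable_itv.
by move=> /eqP; rewrite lebesgue_measure_itv /= lte01 oppr0 adde0 eqe oner_eq0.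
Qed.

Lemma curve_rat_eval (f : {fraction {poly C}}) {g : R -> C} {t} {l : C} :
  (rat_den f).[g t] != 0 -> curve_derive g t l ->
  exists dl, curve_derive (fun u => rat_eval f (g u)) t dl.
Proof. by move=> d0 dg; eexists; exact: (curve_ratio _ _ dg d0). Qed.

Lemma rat_den_neq0 {N D z} : D.[z] != 0 ->
  (rat_den (FracField.tofrac N / FracField.tofrac D)).[z] != 0.
Proof.
move=> Dz; have D0 : D != 0 by apply: contra_neq Dz => ->; rewrite horner0.
have := rat_numdenP N D D0; set f := _ / _ => - [h [_ _ eD _]].
by clearbody f; apply: contra_neq Dz => e; rewrite eD hornerM e mulr0.
Qed.

Lemma ratio_radial N D t : D.[expi t] != 0 ->
  let f := FracField.tofrac N / FracField.tofrac D in
  radial_limit (rat_eval f) t (N.[expi t] / D.[expi t]).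
Proof.
move=> Dt f; rewrite -(rat_evalE Dt) -/f.
have dc : curve_derive (fun u : R => u%:C * expi t) 1 (expi t).
  have := curve_affine 0 (expi t) 1.
  by congr curve_derive; apply/funext => u; rewrite add0r.
have c1 : 1%:C * expi t = expi t by rewrite mul1r.
have [|m dm] := curve_rat_eval f _ dc.
  by rewrite c1; exact: rat_den_neq0.
rewrite /radial_limit -{2}c1; apply: cvg_at_left_filter.
exact: curve_cvg dm.
Qed.

(** A zero of [D] in the closed disc would be a zero of [N] too, since
    [|N| <= |D|] there by continuity. The radial limits are then values of
    [N / D], so [|N| = |D|] at infinitely many points of the circle, which is
    enough for an identity between polynomials. *)
Lemma inner_ratioP {N D} : D != 0 -> coprimep N D ->
  rational_inner (FracField.tofrac N / FracField.tofrac D) ->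
  [/\ forall z, closed_disc z -> `|N.[z]| <= `|D.[z]|,
      forall z, closed_disc z -> D.[z] != 0 &
      forall n, (size N <= n.+1)%N -> (size D <= n.+1)%N ->
        N * revp n N = D * revp n D].
Proof.
move=> D0 cop [_ bd ae].
have le z : closed_disc z -> `|N.[z]| <= `|D.[z]|.
  move=> zc; apply: (disc_dense_norm_le D) => // w wd Dw.
  have := bd w wd; rewrite /closed_disc /= rat_evalE // normrM normfV.
  by rewrite ler_pdivrMr ?normr_gt0 // mul1r.
have Dz z : closed_disc z -> D.[z] != 0.
  move=> /le H; apply/eqP => Dz0; move: H; rewrite Dz0 normr0 normr_le0 => Nz0.
  by have := coprimep_root cop Nz0; rewrite Dz0 eqxx.
split=> // n sN sD.
apply/eqP; rewrite -subr_eq0; apply: contraT => dif0.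
have [s sP] := poly_roots dif0.
have [t [l rl cl]] := ae_circle_avoid _ s ae; case/negP; rewrite -sP rootE.
have ct : circle (expi t : C) by rewrite /circle /= norm_expi.
have Dt : D.[expi t] != 0 by apply: Dz; rewrite /closed_disc /= norm_expi.
have ND : l = N.[expi t] / D.[expi t].
  exact: cvg_unique rl (ratio_radial N D t Dt).
have ND1 : `|N.[expi t]| = `|D.[expi t]|.
  move: cl; rewrite ND /circle /= normrM normfV => /(congr1 ( *%R^~ `|D.[expi t]|)).
  by rewrite /= divfK ?normr_eq0 // mul1r.
rewrite hornerD hornerN !hornerM (horner_revp sN ct) (horner_revp sD ct).
by rewrite mulrCA [X in _ - X]mulrCA -!normCK ND1 subrr eqxx.
Qed.

End InnerRatio.

(** * Phasar derivatives of quotients of polynomials *)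

Section Phasar.
Local Open Scope ring_scope.
Context {R : realType}.
Local Notation C := R[i].
Implicit Types (N D : {poly C}) (z : C) (t v : R).

Lemma curve_expi_comp {g : R -> R} {t v} : is_derive t 1 g v ->
  curve_derive (fun u => expi (g u)) t (v%:C * ('i%C * expi (g t))).
Proof.
move=> dg; split; rewrite /expi /=.
  apply: (is_derive_ext (is_derive1_comp (is_derive_cos (g t)) dg)) => //=.
  by ring.
apply: (is_derive_ext (is_derive1_comp (is_derive_sin (g t)) dg)) => //=.
by ring.
Qed.

Lemma circle_norm_expi t : circle (expi t : C).
Proof. by rewrite /circle /= norm_expi. Qed.

(** When the quotient [f] is unimodular on the circle, [f (expi u)] equals
    [expi (g u)] for the given branch [g] of the argument, and both sides can
    be differentiated. The denominators of [z f' / f = v] are cleared. *)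
Lemma phasar_log_derivative N D z (v : R) :
  (forall w, circle w -> D.[w] != 0 /\ `|N.[w]| = `|D.[w]|) ->
  is_phasar_derivative (rat_eval (FracField.tofrac N / FracField.tofrac D)) z v ->
  z * (N^`().[z] * D.[z] - N.[z] * D^`().[z]) = v%:C * (N.[z] * D.[z]).
Proof.
move=> uni [t [g [-> fg dg]]].
have [Dt _] := uni _ (circle_norm_expi t).
have near_eq : \forall u \near t, expi (g u) = N.[expi u] / D.[expi u].
  apply: filterS fg => u; have [Du ND] := uni _ (circle_norm_expi u).
  rewrite rat_evalE // => -[_ ->]; rewrite normrM normfV ND divff ?mul1r //.
  by rewrite normr_eq0.
have at_t := nbhs_singleton near_eq.
have d1 := curve_near near_eq (curve_expi_comp dg).
have d2 := curve_ratio N D (curve_expi t) Dt.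
have := curve_unique d1 d2; rewrite at_t.
have i0 : 'i%C != 0 :> C by rewrite eq_complex /= oner_eq0 andbF.
move=> e.
apply: (mulfI i0).
transitivity ((N^`().[expi t] * D.[expi t] - N.[expi t] * D^`().[expi t]) /
  D.[expi t] ^+ 2 * ('i%C * expi t) * D.[expi t] ^+ 2); first by field.
by rewrite -e; field.
Qed.

(** In the right half-plane the argument is the arctangent of the slope. *)
Lemma polar_atan (w : C) : 0 < re w ->
  w = `|w| * expi (atan (im w / re w)).
Proof.
case: w => x y /= x0; rewrite normc_def /=.
set q := y / x.
have xq : Num.sqrt (x ^+ 2 + y ^+ 2) = x * Num.sqrt (1 + q ^+ 2).
  rewrite -[in RHS](gtr0_norm x0) -sqrtr_sqr -sqrtrM ?sqr_ge0 //; congr Num.sqrt.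
  by rewrite /q; field; rewrite gt_eqF.
have s0 : Num.sqrt (1 + q ^+ 2) != 0.
  by rewrite sqrtr_eq0 -ltNge ltr_pwDl ?sqr_ge0.
have sin_at : sin (atan q) = q * (Num.sqrt (1 + q ^+ 2))^-1.
  have := atanK q; rewrite /tan cos_atan invrK => e.
  by rewrite -[X in _ = X * _]e mulfK.
apply: complex_ext; rewrite ?reM ?imM /= sin_at cos_atan xq.
  by field.
by rewrite /q; field; rewrite s0 gt_eqF.
Qed.

(** After division by the value at [z], the quotient stays in the right
    half-plane near [z], where the arctangent of its slope is a smooth branch
    of the argument. *)
Lemma phasar_ratio N D z (v : R) : circle z -> N.[z] != 0 -> D.[z] != 0 ->
  z * (N^`().[z] * D.[z] - N.[z] * D^`().[z]) = v%:C * (N.[z] * D.[z]) ->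
  is_phasar_derivative (rat_eval (FracField.tofrac N / FracField.tofrac D)) z v.
Proof.
move=> cz Nz Dz e; have [t zt] := circle_expi cz; rewrite zt in Nz Dz e *.
pose F u := N.[expi u] / D.[expi u].
have Ft : F t != 0 by rewrite mulf_neq0 ?invr_eq0.
have dF := curve_ratio N D (curve_expi t) Dz.
have dG : curve_derive (fun u => (F t)^-1 * F u) t (v%:C * 'i%C).
  have := curveM (curve_cst (F t)^-1 t) dF; congr curve_derive.
  apply: (mulfI Ft); rewrite mul0r add0r mulVKf // /F.
  apply: (mulIf (expf_neq0 2 Dz)).
  transitivity ('i%C * (expi t * (N^`().[expi t] * D.[expi t] - N.[expi t] * D^`().[expi t]))).
    by field.
  by rewrite e; field.
have [al alE] : exists al : R, F t = `|F t| * expi al.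
  have cF : circle (F t / `|F t|).
    by rewrite /circle /= normrM normfV normr_id divff // normr_eq0.
  have [al alE] := circle_expi cF; exists al.
  by rewrite -alE mulrC divfK // normr_eq0.
pose G u := (F t)^-1 * F u.
have Gt : G t = 1 by rewrite /G mulVf.
exists t, (fun u => al + atan (im (G u) / re (G u))); split=> //.
  have reG : \forall u \near t, 0 < re (G u).
    have := curve_cvg_re dG => /cvgr_gt; apply.
    by rewrite -/(G t) Gt ltr01.
  have Du : \forall u \near t, D.[expi u] != 0.
    exact: (curve_neq (curve_horner D (curve_expi t)) Dz).
  have Fu : \forall u \near t, F u != 0 by exact: curve_neq dF Ft.
  near=> u.
  have Dun : D.[expi u] != 0 by near: u.
  rewrite rat_evalE // -/(F u); split; first by near: u.
  rewrite expiD.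
  have FG : F u = F t * G u by rewrite /G mulVKf.
  rewrite [LHS]FG {1}alE [X in _ * X = _]polar_atan; last by near: u.
  by rewrite FG (normrM (F t) (G u)); ring.
have [a b] := dG.
have re0 : re ((F t)^-1 * F t) != 0 by rewrite -/(G t) Gt /= oner_eq0.
have dq : is_derive t 1 (fun u => im (G u) / re (G u)) v.
  apply: (is_derive_ext
    (is_deriveM b (is_deriveV (f := fun u => re ((F t)^-1 * F u)) re0 a))) => //=.
  by rewrite -/(G t) Gt /GRing.scale /=; field.
apply: (is_derive_ext (is_deriveD (is_derive_cst al t 1)
  (is_derive1_comp (is_derive1_atan _) dq))) => //=.
by rewrite Gt /=; field.
Unshelve. all: by end_near. Qed.

End Phasar.

(** * The coefficients of the parametrization *)

Definition param_det {R : realType} (a b c d : {poly R[i]}) : {poly R[i]} :=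
  (a * d - b * c)%R.

Section Parametrization.
Local Open Scope ring_scope.
Context {R : realType}.
Local Notation C := R[i].
Implicit Types (N E : {poly C}) (z : C).

(** Every fact about the solutions of parameter [zeta] is affine in [zeta];
    this splits it into one fact about [a] and [c] and one about [b] and
    [d]. *)
Lemma circle_affine_eq0 (s : seq C) {x y : C} :
  (forall zeta, circle zeta -> zeta \notin s -> zeta * x + y = 0) ->
  x = 0 /\ y = 0.
Proof.
move=> H; have e : x *: 'X + y%:P = 0.
  apply: (circle_poly_eq s) => zeta cz zs.
  by rewrite !hornerE mulrC H.
split.
  by have := congr1 (fun p : {poly C} => p`_1) e; rewrite !coefE mulr1 addr0.
by have := congr1 (fun p : {poly C} => p`_0) e; rewrite !coefE mulr0 add0r.
Qed.

Lemma circle_closed_disc {z} : circle z -> closed_disc z.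
Proof. by rewrite /circle /closed_disc /= => ->. Qed.

Context {n k : nat} {Dt : blaschke_data R n k} {a b c d : {poly C}}.

Lemma node_closed_disc j : closed_disc (node Dt j).
Proof.
have [jk|kj] := ltnP j k; first exact: (circle_closed_disc (node_circle Dt jk).1).
exact: ltW (node_disc Dt kj).1.
Qed.

Lemma bnode_circle j : circle (bnode Dt j).
Proof. exact: (node_circle Dt (j := widen_ord (blaschke_data_le Dt) j) (ltn_ord j)).1. Qed.

(** This is all that the proof uses about a solution. *)
Lemma blaschke_solutionP {N E} : (size N <= n.+1)%N -> (size E <= n.+1)%N ->
  blaschke_solution Dt (FracField.tofrac N / FracField.tofrac E) ->
  [/\ forall z, closed_disc z -> E.[z] != 0 /\ `|N.[z]| <= `|E.[z]|,
      exists q, revp n E = q *: N,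
      forall j, N.[node Dt j] = target Dt j * E.[node Dt j] &
      forall j, let z := bnode Dt j in
        z * (N^`().[z] * E.[z] - N.[z] * E^`().[z]) =
          (phasar Dt j)%:C * (N.[z] * E.[z])].
Proof.
move=> sN sE [inn deg interp phas].
have [E0 cop mx] := rat_degree_full (blaschke_data_gt0 Dt) sN sE deg.
have [le nz /(_ n sN sE) e] := inner_ratioP E0 cop inn.
split.
- by move=> z cz; split; [exact: nz|exact: le].
- exact: unimodular_ratio sN sE cop mx e.
- move=> j; have Ez := nz _ (node_closed_disc j).
  by rewrite -interp rat_evalE // divfK.
move=> j; apply: phasar_log_derivative (phas j) => w cw; split.
  exact/nz/circle_closed_disc.
have := congr1 (fun p : {poly C} => p.[w]) e.
rewrite !hornerM (horner_revp sN cw) (horner_revp sE cw).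
rewrite mulrCA [RHS]mulrCA => /(mulfI (expf_neq0 n (circle_neq0 cw))).
by rewrite -!normCK => /eqP; rewrite eqrXn2 // => /eqP.
Qed.

Hypothesis hparam : normalised_parametrization Dt a b c d.

Lemma generic_solution : exists s : seq C, forall zeta, circle zeta ->
  zeta \notin s -> blaschke_solution Dt (lin_frac a b c d zeta).
Proof.
have [_ fin _ _] := hparam.
have /finite_seqP[s sE] := card_le_finite fin (finite_II k).
exists s => zeta cz zs; apply: contrapT => nsol.
have : [set` s] zeta by rewrite -sE.
by rewrite /= => h; rewrite h in zs.
Qed.

Lemma size_lin {zeta : C} {p q : {poly C}} : (size p <= n.+1)%N -> (size q <= n.+1)%N ->
  (size (zeta *: p + q)%R <= n.+1)%N.
Proof.
move=> sp sq; apply: leq_trans (size_polyD _ _) _; rewrite geq_max sq andbT.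
exact: leq_trans (size_scale_leq _ _) sp.
Qed.

(** Being unimodular for all [zeta] at once makes [c] and [d] the reversals of
    [b] and [a]; the normalisation at [tau] fixes the constant. *)
Lemma param_reversal : exists tau, [/\ circle tau,
    a.[tau] = 1 /\ d.[tau] = 1, b.[tau] = 0 /\ c.[tau] = 0 & forall z, circle z ->
    z ^+ n * (c.[z])^* = tau ^+ n * b.[z] /\
    z ^+ n * (d.[z])^* = tau ^+ n * a.[z]].
Proof.
have [[sa sb sc sd] _ [tau [ct _ [at1 dt1] [bt0 ct0]]] _] := hparam.
have [s sP] := generic_solution.
exists tau; split=> // z cz.
suff : (z ^+ n * (d.[z])^* - tau ^+ n * a.[z] = 0) /\
       (z ^+ n * (c.[z])^* - tau ^+ n * b.[z] = 0).
  by move=> [/eqP + /eqP]; rewrite !subr_eq0 => /eqP -> /eqP ->.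
apply: (circle_affine_eq0 s) => zeta czeta zs.
have [_ [q qE] _ _] := blaschke_solutionP (size_lin sa sb)
  (size_lin sc sd) (sP _ czeta zs).
have zz : zeta * zeta^* = 1.
  by rewrite (circle_conj czeta) divff // circle_neq0.
have ev w : circle w -> w ^+ n * (zeta * c.[w] + d.[w])^* = q * (zeta * a.[w] + b.[w]).
  move=> cw; have := congr1 (fun p : {poly C} => p.[w]) qE.
  by rewrite (horner_revp (size_lin sc sd) cw) !hornerE.
have qtau : tau ^+ n = q * zeta.
  by have := ev _ ct; rewrite at1 dt1 bt0 ct0 mulr0 add0r conjC1 addr0 !mulr1.
have := ev z cz; rewrite rmorphD /= conjM => e.
have -> : zeta * (z ^+ n * (d.[z])^* - tau ^+ n * a.[z]) +
   (z ^+ n * (c.[z])^* - tau ^+ n * b.[z]) =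
   zeta * (z ^+ n * (zeta^* * (c.[z])^* + (d.[z])^*)) - tau ^+ n * (zeta * a.[z] + b.[z])
   + (1 - zeta * zeta^*) * (z ^+ n * (c.[z])^*) by ring.
rewrite zz subrr mul0r addr0 e qtau; ring.
Qed.

Lemma param_interpolation j :
  a.[node Dt j] = target Dt j * c.[node Dt j] /\
  b.[node Dt j] = target Dt j * d.[node Dt j].
Proof.
have [[sa sb sc sd] _ _ _] := hparam; have [s sP] := generic_solution.
suff : (a.[node Dt j] - target Dt j * c.[node Dt j] = 0) /\
       (b.[node Dt j] - target Dt j * d.[node Dt j] = 0).
  by move=> [/eqP + /eqP]; rewrite !subr_eq0 => /eqP -> /eqP ->.
apply: (circle_affine_eq0 s) => zeta czeta zs.
have [_ _ /(_ j) e _] := blaschke_solutionP (size_lin sa sb)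
  (size_lin sc sd) (sP _ czeta zs).
rewrite !hornerE in e; move: e.
move: (a.[_]) (b.[_]) (c.[_]) (d.[_]) (target _ _) => a1 b1 c1 d1 eta e.
transitivity (zeta * a1 + b1 - eta * (zeta * c1 + d1)); first by ring.
by rewrite e subrr.
Qed.

Lemma param_phasar j : let z := bnode Dt j in
  let eta := target Dt (widen_ord (blaschke_data_le Dt) j) in
  let rho := (phasar Dt j)%:C in
  z * (a^`().[z] - eta * c^`().[z]) = rho * eta * c.[z] /\
  z * (b^`().[z] - eta * d^`().[z]) = rho * eta * d.[z].
Proof.
move=> z eta rho.
have [[sa sb sc sd] _ _ _] := hparam; have [s sP] := generic_solution.
suff : (z * (a^`().[z] - eta * c^`().[z]) - rho * eta * c.[z] = 0) /\
       (z * (b^`().[z] - eta * d^`().[z]) - rho * eta * d.[z] = 0).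
  by move=> [/eqP + /eqP]; rewrite !subr_eq0 => /eqP -> /eqP ->.
apply: (circle_affine_eq0 s) => zeta czeta zs.
have [nz _ _ /(_ j) /= e] := blaschke_solutionP (size_lin sa sb)
  (size_lin sc sd) (sP _ czeta zs).
have [az bz] : a.[z] = eta * c.[z] /\ b.[z] = eta * d.[z] by exact: param_interpolation.
have [Ez _] := nz z (circle_closed_disc (bnode_circle j)).
rewrite -/z -/rho !derivD !derivZ !hornerE az bz in e.
rewrite !hornerE in Ez.
apply: (mulIf Ez); rewrite mul0r.
transitivity (z *
  ((zeta * a^`().[z] + b^`().[z]) * (zeta * c.[z] + d.[z]) -
   (zeta * (eta * c.[z]) + eta * d.[z]) * (zeta * c^`().[z] + d^`().[z])) -
  rho * ((zeta * (eta * c.[z]) + eta * d.[z]) * (zeta * c.[z] + d.[z]))); first by ring.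
by rewrite e [in X in _ - X]mulrA subrr.
Qed.

(** The exceptional parameters are limits of parameters of solutions. *)
Lemma param_le {zeta z} : circle zeta -> closed_disc z ->
  `|zeta * a.[z] + b.[z]| <= `|zeta * c.[z] + d.[z]|.
Proof.
move=> czeta cz.
have [[sa sb sc sd] _ _ _] := hparam; have [s sP] := generic_solution.
have dc p q : curve_derive (fun u => (zeta * expi u) * p + q) 0
    (zeta * 'i%C * p).
  have := curveD (curveM (curveM (curve_cst zeta 0)
    (curve_expi 0)) (curve_cst p 0)) (curve_cst q 0).
  by congr curve_derive; rewrite expi0; ring.
have := curve_norm_le (dc a.[z] b.[z]) (dc c.[z] d.[z]).
rewrite expi0 mulr1; apply.
have ns := near_rotation_notin s czeta.
near=> u.
have cu : circle (zeta * expi u).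
  by move: czeta; rewrite /circle /= normrM norm_expi mulr1.
have us : zeta * expi u \notin s by near: u.
have [le _ _ _] := blaschke_solutionP (size_lin sa sb)
  (size_lin sc sd) (sP _ cu us).
by have [_ lez] := le z cz; rewrite !hornerE in lez.
Unshelve. all: by end_near. Qed.

Lemma param_neq0 {z} : closed_disc z -> ~ (c.[z] = 0 /\ d.[z] = 0).
Proof.
move=> cz [c0 d0].
have [[sa sb sc sd] _ _ _] := hparam; have [s sP] := generic_solution.
have [zeta czeta zs] := circle_avoid s.
have [le _ _ _] := blaschke_solutionP (size_lin sa sb)
  (size_lin sc sd) (sP _ czeta zs).
by have [nz _] := le z cz; rewrite !hornerE c0 d0 mulr0 addr0 eqxx in nz.
Qed.

(** The unimodular parameter [zeta = - d / c] annihilates [zeta c + d], hence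
    also [zeta a + b] by [param_le]: the columns are proportional. *)
Lemma param_eq_det {z} : closed_disc z -> `|c.[z]| = `|d.[z]| ->
  (param_det a b c d).[z] = 0.
Proof.
move=> cz e; rewrite /param_det !hornerE.
have [c0|c0] := eqVneq c.[z] 0.
  by move: e; rewrite c0 normr0 => /esym/normr0_eq0 ->; rewrite !mulr0 subrr.
have czeta : circle (- d.[z] / c.[z]).
  by rewrite /circle /= normrM normrN normfV -e divff // normr_eq0.
have := param_le czeta cz; rewrite divfK // addNr normr0 normr_le0.
rewrite addr_eq0 => /eqP ab.
have -> : b.[z] = d.[z] / c.[z] * a.[z] by rewrite -[LHS]opprK -ab; ring.
by field.
Qed.

End Parametrization.

(** * The coefficients [c] and [d] on the closed disc *)

Section Domination.
Local Open Scope ring_scope.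
Context {R : realType}.
Local Notation C := R[i].
Implicit Types (z : C).
Context {n k : nat} {Dt : blaschke_data R n k} {a b c d : {poly C}}.
Hypothesis hparam : normalised_parametrization Dt a b c d.

Lemma closed_disc_segment (z w : C) (u : R) : closed_disc z -> closed_disc w ->
  0 <= u <= 1 -> closed_disc (z + u%:C * (w - z)).
Proof.
rewrite /closed_disc /= => z1 w1 /andP[u0 u1].
have -> : z + u%:C * (w - z) = (1 - u%:C) * z + u%:C * w by ring.
apply: (le_trans (ler_normD _ _)); rewrite !normrM.
have -> : `|u%:C| = u%:C :> C by rewrite normc_real ger0_norm.
have -> : `|1 - u%:C| = 1 - u%:C :> C.
  by rewrite -(rmorph1 (real_complex R)) -rmorphB normc_real ger0_norm ?subr_ge0.
have uC0 : 0 <= u%:C :> C by rewrite (lecR 0 u).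
have uC1 : 0 <= 1 - u%:C :> C by rewrite subr_ge0 (lecR u 1).
by rewrite -[leRHS](subrK u%:C); apply: lerD; rewrite ler_piMr.
Qed.

(** Where [|c| = |d|], the determinant vanishes. Moving along a segment from
    [tau], where [|c| < |d|], to a point where [|c| > |d|] would meet such a
    place; but the determinant has finitely many zeros, and a small rotation of
    the segment about [tau] avoids them all. *)
Lemma param_dominated {z} : closed_disc z -> `|c.[z]| <= `|d.[z]|.
Proof.
have [tau [ct [at1 dt1] [bt0 ct0] _]] := param_reversal hparam.
have Wt : (param_det a b c d).[tau] = 1.
  by rewrite /param_det !hornerE at1 dt1 bt0 mul1r mul0r subr0.
have W0 : param_det a b c d != 0.
  by apply/eqP => e; move: Wt; rewrite e horner0 => /esym/eqP; rewrite oner_eq0.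
have [s sP] := poly_roots W0.
apply: (disc_dense_norm_le 1 c d (oner_neq0 _)) => z0 dz0 _.
rewrite /disc /= in dz0.
rewrite -normsq_le leNgt; apply/negP => lt0.
have z0t : z0 - tau != 0.
  by rewrite subr_eq0; apply/eqP => e; move: dz0; rewrite e ct ltxx.
pose zx (x : R) := z0 + x%:C * ('i%C * (z0 - tau)).
have zx0 : zx 0 = z0 by rewrite /zx mul0r addr0.
have dzx : curve_derive zx 0 ('i%C * (z0 - tau)) by exact: curve_affine.
(* [zx x - tau] is [(1 + i x) (z0 - tau)], so a zero [v] lies on the line from
   [tau] to [zx x] only if [x] is the slope of [(v - tau) / (z0 - tau)]. *)
pose bad := [seq im ((v - tau) / (z0 - tau)) /
                 re ((v - tau) / (z0 - tau)) | v <- s].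
have Ngood : \forall x \near (0 : R)^'+, x \notin bad.
  apply: near_notin => y _.
  have [y0|y0] := leP y 0.
    by near=> x; rewrite gt_eqF // (le_lt_trans y0) //; near: x; exact: nbhs_right_gt.
  by near=> x; rewrite lt_eqF //; near: x; exact: nbhs_right_lt.
have Nlt : \forall x \near (0 : R)^'+, normsq d.[zx x] < normsq c.[zx x].
  have Hc := curve_cvg_normsq (curve_horner c dzx).
  have Hd := curve_cvg_normsq (curve_horner d dzx).
  have H : normsq c.[zx u] - normsq d.[zx u] @[u --> 0^'+] -->
      normsq c.[z0] - normsq d.[z0].
    by rewrite -zx0; apply: cvg_at_right_filter; exact: cvgB Hc Hd.
  have L : 0 < normsq c.[z0] - normsq d.[z0] by rewrite subr_gt0.
  by apply: filterS (cvgr_gt _ H _ L) => x; rewrite subr_gt0.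
have Ndisc : \forall x \near (0 : R)^'+, normsq (zx x) < 1.
  have H : normsq (zx u) @[u --> 0^'+] --> normsq z0.
    by rewrite -zx0; apply: cvg_at_right_filter; exact: curve_cvg_normsq dzx.
  by apply: (cvgr_lt _ H); rewrite -ltcR normsqE exprn_ilt1.
near (0 : R)^'+ => x.
have ltx : normsq d.[zx x] < normsq c.[zx x] by near: x.
have cdx : closed_disc (zx x).
  have : normsq (zx x) < 1 by near: x.
  rewrite -ltcR normsqE /closed_disc /= => h; rewrite ltW //.
  by rewrite -(@expr_lt1 _ 2).
have xbad : x \notin bad by near: x.
pose pt (u : R) := tau + u%:C * (zx x - tau).
have dpt u : curve_derive pt u (zx x - tau) by exact: curve_affine.
pose h (u : R) := normsq d.[pt u] - normsq c.[pt u].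
have hc : {within `[0, 1], continuous h}.
  apply: continuous_subspaceT => u.
  by apply: cvgB; [exact: curve_cvg_normsq (curve_horner d (dpt u))
    |exact: curve_cvg_normsq (curve_horner c (dpt u))].
have h0 : 0 <= h 0.
  rewrite /h /pt mul0r addr0 ct0 dt1 subr_ge0 normsq_le normr0 normr1.
  exact: ler01.
have h1 : h 1 <= 0.
  by rewrite /h /pt mul1r [tau + _]addrC subrK subr_le0 ltW.
have [|u u01 hu] := IVT ler01 hc (v := 0).
  by rewrite ge_min h1 orbT le_max h0.
have cpt : closed_disc (pt u).
  by apply: closed_disc_segment => //; exact: circle_closed_disc.
have : root (param_det a b c d) (pt u).
  apply/eqP; apply: (param_eq_det hparam) => //.
  have e : normsq c.[pt u] = normsq d.[pt u].
    by apply/eqP; rewrite eq_sym -subr_eq0; apply/eqP.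
  by apply/eqP; rewrite eq_le -!normsq_le e lexx.
move=> rpt; have u0 : u != 0.
  by apply: contraTneq rpt => ->; rewrite /root /pt mul0r addr0 Wt oner_eq0.
move/negP: xbad; apply; apply/mapP; exists (pt u); first by rewrite -sP.
have -> : (pt u - tau) / (z0 - tau) = u +i* (u * x).
  apply: (canLR (mulfK z0t)).
  have -> : u +i* (u * x) = u%:C * (1 + x%:C * 'i%C).
    by apply: complex_ext; rewrite ?reM ?imM /=; ring.
  by rewrite /pt /zx; ring.
by rewrite /= mulrAC divff // mul1r.
Unshelve. all: by end_near. Qed.

End Domination.

(** * The zeros of the determinant *)

Section Factorization.
Local Open Scope ring_scope.
Context {R : realType}.
Local Notation C := R[i].
Implicit Types (z w : C) (s : seq C) (p : {poly C}).

Definition prod_roots s : {poly C} := \prod_(x <- s) ('X - x%:P).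

Lemma size_prod_roots s : size (prod_roots s) = (size s).+1.
Proof. exact: size_prod_XsubC. Qed.

Lemma prod_roots_neq0 s : prod_roots s != 0.
Proof. by rewrite -size_poly_gt0 size_prod_roots. Qed.

Lemma revp_prod_roots s :
  revp (size s) (prod_roots s) = \prod_(x <- s) (1 - x^* *: 'X).
Proof.
apply: (circle_poly_eq [::]) => z cz _.
rewrite horner_revp ?size_prod_roots // /prod_roots !horner_prod.
elim: s => [|x s IHs]; first by rewrite !big_nil expr0 mul1r conjC1.
rewrite !big_cons conjM exprS mulrACA IHs; congr (_ * _).
rewrite !hornerE rmorphB /= mulrBr (circle_conj cz) divff ?circle_neq0 //.
by rewrite mulrC.
Qed.

Lemma revp_prod_roots_neq0 {s w} : (forall x, x \in s -> `|x| * `|w| < 1) ->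
  (\prod_(x <- s) (1 - x^* *: 'X)).[w] != 0.
Proof.
move=> H; rewrite horner_prod prodf_seq_neq0; apply/allP => x xs /=.
rewrite !hornerE subr_eq0; apply/eqP => e.
by have := H x xs; rewrite -(norm_conjC x) -normrM -e normr1 ltxx.
Qed.

Lemma revpZ n (x : C) p : (size p <= n.+1)%N -> revp n (x *: p) = x^* *: revp n p.
Proof.
move=> sp; apply: (circle_poly_eq [::]) => z cz _.
rewrite hornerZ !horner_revp // ?hornerZ ?conjM; first by ring.
exact: leq_trans (size_scale_leq _ _) sp.
Qed.

Lemma double_root (p : {poly C}) z : p.[z] = 0 -> p^`().[z] = 0 ->
  ('X - z%:P) ^+ 2 %| p.
Proof.
move=> /eqP/factor_theorem[q ->]; rewrite derivM !hornerE derivXsubC hornerC subrr.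
rewrite mulr0 add0r mulr1 => /eqP/factor_theorem[r ->].
by rewrite -mulrA -expr2 dvdp_mull.
Qed.

Lemma prod_roots_dvdp s (p : {poly C}) : uniq s -> {in s, forall x, p.[x] = 0} ->
  prod_roots s %| p.
Proof.
move=> us H; apply: uniq_roots_dvdp; last by rewrite uniq_rootsE.
by apply/allP => x xs; rewrite rootE H.
Qed.

(** Conjugation exchanges the roles of [x] and [y]. *)
Lemma reversal_sym {n} {z tau x y : C} : circle z -> circle tau ->
  z ^+ n * y^* = tau ^+ n * x -> z ^+ n * x^* = tau ^+ n * y.
Proof.
move=> cz ct /(congr1 (fun t => (t : C)^*)); rewrite !conjM !conjXn conjCK.
rewrite (circle_conj cz) (circle_conj ct) !exprVn => /(congr1 ( *%R (z ^+ n * tau ^+ n))).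
have z0 := expf_neq0 n (circle_neq0 cz); have t0 := expf_neq0 n (circle_neq0 ct).
move: (z ^+ n) (tau ^+ n) z0 t0 => u v u0 v0 e.
transitivity (u * v * (v^-1 * x^*)); first by field.
by rewrite -e; field.
Qed.

Context {n k : nat} {Dt : blaschke_data R n k} {a b c d : {poly C}}.
Hypothesis hparam : normalised_parametrization Dt a b c d.

Local Notation W := (param_det a b c d).

Definition nodes : seq C := [seq node Dt j | j <- enum 'I_n].

Lemma uniq_nodes : uniq nodes.
Proof. by rewrite map_inj_uniq ?enum_uniq //; exact: node_inj. Qed.

Lemma mem_nodes j : node Dt j \in nodes.
Proof. by rewrite map_f ?mem_enum. Qed.

Lemma nodesP {z} : z \in nodes -> exists j, z = node Dt j.
Proof. by case/mapP => j _ ->; exists j. Qed.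

Lemma mem_take_nodes j : (node Dt j \in take k nodes) = (j < k)%N.
Proof.
rewrite in_take ?mem_nodes // index_map; last exact: node_inj.
by rewrite index_enum_ord.
Qed.

Lemma mem_drop_nodes {z} : z \in drop k nodes -> disc z.
Proof.
move=> zd; have [j zE] := nodesP (mem_drop zd).
have [jk|/(node_disc Dt)[]] := ltnP j k; last by rewrite zE.
have := uniq_nodes; rewrite -(cat_take_drop k nodes) cat_uniq => /and3P[_ /hasPn/(_ z zd)].
by rewrite /= zE mem_take_nodes jk.
Qed.

Lemma det_neq0 : W != 0.
Proof.
have [tau [_ [at1 dt1] [bt0 ct0] _]] := param_reversal hparam.
apply/eqP => e; have : W.[tau] = 0 by rewrite e horner0.
by rewrite /param_det !hornerE at1 dt1 bt0 mul1r mul0r subr0 => /eqP; rewrite oner_eq0.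
Qed.

Lemma size_det : (size W <= (n + n).+1)%N.
Proof.
have [[sa sb sc sd] _ _ _] := hparam.
have sM (p q : {poly C}) : (size p <= n.+1)%N -> (size q <= n.+1)%N ->
    (size (p * q)%R <= (n + n).+1)%N.
  by move=> sp sq; apply: leq_trans (size_polyMleq _ _) _; move: sp sq; clear; lia.
by apply: leq_trans (size_polyD _ _) _; rewrite geq_max size_polyN !sM.
Qed.

Lemma revp_det : exists2 u : C, u != 0 & revp (n + n) W = u *: W.
Proof.
have [tau [ct _ _ rv]] := param_reversal hparam.
exists (tau ^+ n * tau ^+ n); first by rewrite mulf_neq0 ?expf_neq0 ?circle_neq0.
apply: (circle_poly_eq [::]) => z cz _.
rewrite (horner_revp size_det cz) /param_det !hornerE.
have [e1 e2] := rv z cz.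
have e3 := reversal_sym cz ct e1.
have e4 := reversal_sym cz ct e2.
rewrite rmorphB /= !conjM exprD mulrBr mulrACA e4 e2 [X in _ - X]mulrACA e3 e1.
ring.
Qed.

Lemma det_node j : W.[node Dt j] = 0.
Proof.
have [aj bj] := param_interpolation hparam j.
by rewrite /param_det !hornerE aj bj; ring.
Qed.

(** At a node on the circle the columns agree up to the factor [eta], and by
    [param_phasar] so do their derivatives up to the same correction; the zero
    of the determinant is double. *)
Lemma deriv_det_bnode (j : 'I_k) : W^`().[bnode Dt j] = 0.
Proof.
have [aj bj] := param_interpolation hparam
  (widen_ord (blaschke_data_le Dt) j).
have := param_phasar hparam j; rewrite /= -/(bnode Dt j) in aj bj *.
have z0 := circle_neq0 (bnode_circle (Dt := Dt) j).
move: (bnode Dt j) (target _ _) (_%:C) z0 aj bj => z eta rho z0 az bz [ea eb].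
apply: (mulfI z0); rewrite mulr0 /param_det derivB !derivM !hornerE az bz.
transitivity (z * (a^`().[z] - eta * c^`().[z]) * d.[z] -
              z * (b^`().[z] - eta * d^`().[z]) * c.[z]); first by ring.
by rewrite ea eb; ring.
Qed.

(** The known zeros exhaust the determinant: a cofactor [V] is left, of degree
    at most [n - k], and the reversal symmetry moves the [n - k] zeros in the
    disc to zeros of [V] outside the closed disc. *)
Lemma det_factor : exists2 V : {poly C},
  W = prod_roots nodes * prod_roots (take k nodes) * V &
  forall z, closed_disc z -> V.[z] != 0.
Proof.
have sn : size nodes = n by rewrite size_map size_enum_ord.
have kn := blaschke_data_le Dt.
have sk : size (take k nodes) = k by rewrite size_takel // sn.
have sd : size (drop k nodes) = (n - k)%N by rewrite size_drop sn.
have /dvdpP[W1 W1E] : prod_roots nodes %| W.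
  apply: prod_roots_dvdp uniq_nodes _ => x /nodesP[j ->]; exact: det_node.
have W0 := det_neq0.
have W10 : W1 != 0 by apply: contra_neq W0 => e; rewrite W1E e mul0r.
have /dvdpP[V VE] : prod_roots (take k nodes) %| W1.
  apply: prod_roots_dvdp; first exact: take_uniq uniq_nodes.
  move=> x xk; have [j xE] := nodesP (mem_take xk).
  rewrite xE mem_take_nodes in xk.
  have xb : x = bnode Dt (Ordinal xk).
    by rewrite xE /bnode; congr node; apply: val_inj.
  have : (2 <= mup x W)%N.
    rewrite mup_geq // double_root //; first by rewrite xE det_node.
    by rewrite xb deriv_det_bnode.
  rewrite W1E mupM ?prod_roots_neq0 // /prod_roots mu_prod_XsubC.
  rewrite count_uniq_mem ?uniq_nodes // xE mem_nodes addn1 ltnS => h.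
  by apply/eqP; rewrite -rootE; apply: contraTT h => nr; rewrite mupNroot.
have WE : W = prod_roots nodes * prod_roots (take k nodes) * V.
  by rewrite W1E VE; ring.
exists V => // z cz.
have V0 : V != 0 by apply: contra_neq W10 => e; rewrite VE e mul0r.
have sM : size (prod_roots nodes * prod_roots (take k nodes))%R = (n + k).+1.
  by rewrite size_mul ?prod_roots_neq0 // !size_prod_roots sn sk addSn addnS.
have sV : (size V <= (n - k).+1)%N.
  have := size_det; rewrite WE size_mul ?mulf_neq0 ?prod_roots_neq0 // sM.
  by move: (size V) kn => v; clear; lia.
have [u u0 rW] := revp_det.
have rE : revp (n + n) W = (\prod_(x <- nodes) (1 - x^* *: 'X)) *
    (\prod_(x <- take k nodes) (1 - x^* *: 'X)) * revp (n - k) V.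
  have -> : (n + n = n + k + (n - k))%N by move: kn; clear; lia.
  rewrite WE revpM ?sM // revpM ?size_prod_roots ?sn ?sk //.
  by rewrite -[X in revp X (prod_roots nodes)]sn -[X in revp X (prod_roots (take _ _))]sk
    !revp_prod_roots.
have /dvdpP[q qE] : prod_roots (drop k nodes) %| revp (n - k) V.
  apply: prod_roots_dvdp; first exact: drop_uniq uniq_nodes.
  move=> x xd; have dx : `|x| < 1 by exact: mem_drop_nodes.
  have := congr1 (fun p : {poly C} => p.[x]) rE.
  have Wx : W.[x] = 0 by have [j ->] := nodesP (mem_drop xd); exact: det_node.
  have lt1 y : y \in nodes -> `|y| * `|x| < 1.
    move=> /nodesP[j ->]; have := node_closed_disc (Dt := Dt) j; rewrite /closed_disc /=.
    by move=> yl; apply: le_lt_trans dx; rewrite ler_piMl.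
  rewrite /= rW hornerZ Wx mulr0 !hornerM => /esym/eqP; rewrite !mulf_eq0.
  rewrite (negPf (revp_prod_roots_neq0 lt1)).
  rewrite (negPf (revp_prod_roots_neq0 _)); last by move=> y /mem_take /lt1.
  by move=> /eqP.
have rV0 : revp (n - k) V != 0 by rewrite revp_eq0.
have q0 : q != 0 by apply: contra_neq rV0 => e; rewrite qE e mul0r.
have sq : (size q <= 1)%N.
  have := size_revp (n - k) V.
  rewrite qE size_mul ?prod_roots_neq0 // size_prod_roots sd.
  by move: (size q) => v; clear; lia.
have -> : V = (q`_0)^* *: \prod_(x <- drop k nodes) (1 - x^* *: 'X).
  rewrite -(revpK sV) qE [q in LHS](size1_polyC sq) mul_polyC -sd revpZ ?size_prod_roots //.
  by rewrite revp_prod_roots.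
rewrite hornerZ mulf_neq0 ?conjC_eq0 //.
  by apply: contra_neq q0 => e; rewrite (size1_polyC sq) e.
apply: revp_prod_roots_neq0 => x xd.
have dx : `|x| < 1 by exact: mem_drop_nodes.
by apply: le_lt_trans dx; rewrite ler_piMr.
Qed.

Lemma det_root {z} : closed_disc z -> (W.[z] == 0) = (z \in nodes).
Proof.
move=> cz; have [V WE /(_ z cz) Vz] := det_factor.
rewrite -rootE WE !rootM !root_prod_XsubC [root V z]rootE (negPf Vz) orbF.
by apply/orb_idr => /mem_take.
Qed.

Lemma mup_det j : mup (node Dt j) W = (1 + (j < k))%N.
Proof.
have [V WE Vz] := det_factor.
have Vj : ~~ root V (node Dt j) by rewrite rootE Vz //; exact: node_closed_disc.
rewrite WE mupMl // mupM ?prod_roots_neq0 // !mu_prod_XsubC.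
rewrite !count_uniq_mem ?take_uniq ?uniq_nodes //.
by rewrite mem_nodes mem_take_nodes.
Qed.

End Factorization.

Arguments nodes {R n k} Dt.

(** * The symmetrized bidisc *)

Section GammaPoints.
Local Open Scope ring_scope.
Context {R : realType}.
Local Notation C := R[i].
Implicit Types (z w s p omega : C).

Lemma norm_real z : exists2 x : R, 0 <= x & `|z| = x%:C.
Proof.
exists (Num.sqrt (re z ^+ 2 + im z ^+ 2)); first exact: sqrtr_ge0.
exact: normc_def.
Qed.

(** The quantity in the second hypothesis is [z (1 - |w|^2) + w (1 - |z|^2)].
    Suppose [|z| > 1]. If [|z w| < 1], the bound forces
    [|z| + |w| <= 1 + |z w|], which fails. If [|z w| = 1], it forces [w] to be
    a positive multiple of [z], and then [|z + w| = |z| + |w| > 2]. *)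
Lemma symmetrized_norm_le1 z w : `|z + w| <= 2 ->
  `|z + w - (z + w)^* * (z * w)| <= 1 - `|z * w| ^+ 2 -> `|z| <= 1.
Proof.
move=> s2 sp; have [X X0 XE] := norm_real z; have [Y Y0 YE] := norm_real w.
rewrite XE (lecR X 1) leNgt; apply/negP => X1.
have zz : z * z^* = (X ^+ 2)%:C by rewrite -normCK XE rmorphXn.
have ww : w * w^* = (Y ^+ 2)%:C by rewrite -normCK YE rmorphXn.
have pE : `|z * w| = (X * Y)%:C by rewrite normrM XE YE rmorphM.
have tE : z + w - (z + w)^* * (z * w) = z * (1 - Y ^+ 2)%:C + w * (1 - X ^+ 2)%:C.
  by rewrite !rmorphB /= -zz -ww rmorph1 rmorphD /=; ring.
have dE : 1 - `|z * w| ^+ 2 = (1 - (X * Y) ^+ 2)%:C by rewrite pE rmorphB rmorphXn.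
rewrite tE dE in sp.
have XY1 : X * Y <= 1.
  have := le_trans (normr_ge0 _) sp; rewrite (lecR 0 _) subr_ge0.
  by rewrite expr_le1 // mulr_ge0.
have Y1 : Y < 1 by nra.
have low : X * (1 - Y ^+ 2) - Y * (X ^+ 2 - 1) <= 1 - (X * Y) ^+ 2.
  rewrite -lecR; apply: le_trans sp.
  have -> : (X * (1 - Y ^+ 2) - Y * (X ^+ 2 - 1))%:C =
      `|z * (1 - Y ^+ 2)%:C| - `|w * (1 - X ^+ 2)%:C|.
    rewrite !normrM XE YE !normc_real.
    rewrite (ger0_norm (_ : 0 <= 1 - Y ^+ 2)); last by nra.
    rewrite (ler0_norm (_ : 1 - X ^+ 2 <= 0)); last by nra.
    by rewrite rmorphB !rmorphM opprB.
  exact: lerB_normD.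
have [XYlt|XYge] := ltP (X * Y) 1.
  have : (X + Y) * (1 - X * Y) <= (1 + X * Y) * (1 - X * Y) by lra.
  by rewrite ler_pM2r ?subr_gt0 //; nra.
have XYe : X * Y = 1 by apply/le_anti; rewrite XY1.
have wz : w = z * (Y ^+ 2)%:C.
  move: sp; rewrite XYe expr1n subrr normr_le0 => /eqP e.
  have X2 : (X ^+ 2 - 1)%:C != 0 :> C.
    by rewrite -[0]/((0 : R)%:C) (inj_eq (@complexI R)); apply: lt0r_neq0; nra.
  apply: (mulIf X2).
  have -> : z * (Y ^+ 2)%:C * (X ^+ 2 - 1)%:C = z * (1 - Y ^+ 2)%:C.
    rewrite -mulrA -rmorphM; congr (_ * _%:C); rewrite mulrBr mulr1 -exprMn.
    by rewrite [Y * X]mulrC XYe expr1n.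
  apply/eqP; rewrite -subr_eq0 -oppr_eq0; apply/eqP; rewrite -[RHS]e.
  by rewrite -[(1 - X ^+ 2)]opprB rmorphN; ring.
have nE : `|z + w| = (X * (1 + Y ^+ 2))%:C.
  have -> : z + w = z * (1 + Y ^+ 2)%:C by rewrite wz rmorphD /= rmorph1; ring.
  by rewrite normrM XE normc_real ger0_norm ?addr_ge0 ?sqr_ge0 ?ler01 // -rmorphM.
move: s2; rewrite nE -(rmorph_nat (real_complex R)) lecR.
have -> : X * (1 + Y ^+ 2) = X + Y by rewrite mulrDr mulr1 expr2 mulrA XYe mul1r.
by move: XYe X1 Y0; clear; nra.
Qed.

Lemma quadratic_roots s p : exists z w, s = z + w /\ p = z * w.
Proof.
pose r := sqrtC (s ^+ 2 - 4 * p); exists ((s + r) / 2), ((s - r) / 2); split.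
  by field.
have r2 : r ^+ 2 = s ^+ 2 - 4 * p by exact: sqrtCK.
transitivity ((s ^+ 2 - r ^+ 2) / 4); last by field.
by rewrite r2; field.
Qed.

Lemma Gamma_of_bounds s p : `|s| <= 2 -> `|s - s^* * p| <= 1 - `|p| ^+ 2 ->
  Gamma (s, p).
Proof.
have [z [w [-> ->]]] := quadratic_roots s p => s2 sp.
exists z, w; split=> //; first exact: symmetrized_norm_le1 s2 sp.
by apply: (symmetrized_norm_le1 w z); rewrite [w + z]addrC ?[w * z]mulrC.
Qed.

(** The bound on [s - s^* p] holds as an equality, and two points of the closed
    disc with unimodular product are unimodular. *)
Lemma bGamma_of_bounds s p : `|s| <= 2 -> s = s^* * p -> `|p| = 1 -> bGamma (s, p).
Proof.
move=> s2 sp p1.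
have [|z [w [z1 w1 [sE pE]]]] := Gamma_of_bounds s p s2.
  by rewrite -sp subrr normr0 p1 expr1n subrr.
have zw : `|z| * `|w| = 1 by rewrite -normrM -pE.
exists z, w; split; [| |by rewrite sE pE]; apply/le_anti; rewrite ?z1 ?w1 /= -zw.
  by rewrite ler_piMr.
by rewrite ler_piMl.
Qed.

(** Expanding the squares leaves a bound on the real part of [omega t], with
    [t = s - s^* p]; the best [omega] makes it [|t|]. *)
Lemma Gamma_of_pencil s p : `|s| <= 2 ->
  (forall omega, circle omega -> `|2 * omega * p - s| <= `|2 - omega * s|) ->
  Gamma (s, p).
Proof.
move=> s2 H; apply: Gamma_of_bounds => //.
set t := s - s^* * p.
have [omega comega ot] : exists2 omega, circle omega & omega * t = `|t|.
  have [t0|t0] := eqVneq t 0.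
    by exists 1; rewrite ?t0 ?normr0 ?mulr0 // /circle /= normr1.
  exists (t^* / `|t|).
    by rewrite /circle /= normrM norm_conjC normfV normr_id divff // normr_eq0.
  by rewrite mulrAC [t^* * _]mulrC -normCK expr2 mulfK // normr_eq0.
have oo : omega * omega^* = 1.
  by rewrite (circle_conj comega) divff // circle_neq0.
have := H omega comega; rewrite -ler_sqr ?nnegrE // !normCK => le.
have ot' : omega^* * t^* = `|t| by rewrite -conjM ot conj_normC.
rewrite -(@ler_pM2l _ 4) ?ltr0n //.
rewrite -subr_ge0.
suff -> : 4 * (1 - p * p^*) - 4 * `|t| =
   (2 - omega * s) * (2 - omega * s)^* - (2 * omega * p - s) * (2 * omega * p - s)^*.
  by rewrite subr_ge0.
have -> : 4 * `|t| = 2 * (omega * t) + 2 * (omega^* * t^*) by rewrite ot ot'; ring.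
rewrite /t !rmorphB !rmorphM /= conjCK !conjC_nat.
transitivity (4 - 4 * (omega * omega^*) * (p * p^*) -
  (2 * (omega * (s - s^* * p)) + 2 * (omega^* * (s^* - s * p^*))) +
  (omega * omega^* - 1) * s * s^*); first by rewrite oo; ring.
ring.
Qed.

Lemma royalP s p : royal_variety (s, p) <-> s ^+ 2 = 4 * p.
Proof.
split=> [[z [-> ->]]|e]; first by ring.
exists (s / 2); congr pair; first by field.
apply: (mulfI (_ : (4 : C) != 0)); first by rewrite pnatr_eq0.
by rewrite -e; field.
Qed.

Lemma derivable_hornerC (q : {poly C}) z : derivable (horner q : C^o -> C^o) z 1.
Proof.
elim/poly_ind: q => [|q x IHq].
  have -> : horner (0 : {poly C}) = cst 0 by apply/funext => u; rewrite horner0.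
  exact: derivable_cst.
have -> : horner (q * 'X + x%:P) = (horner q : C^o -> C^o) * id + cst x.
  by apply/funext => u; rewrite !hornerE.
apply: derivableD; last exact: derivable_cst.
by apply: derivableM; [exact: IHq|exact: derivable_id].
Qed.

Lemma holomorphic_ratio (N D : {poly C}) : (forall z, disc z -> D.[z] != 0) ->
  holomorphic_on_disc (rat_eval (FracField.tofrac N / FracField.tofrac D)).
Proof.
move=> D0 z dz; set f := _ / _.
have d0 : (rat_den f).[z] != 0 by apply: rat_den_neq0; exact: D0.
apply: (@derivableM _ _ (horner (rat_num f) : C^o -> C^o)
  (fun u => (horner (rat_den f) u)^-1 : C^o)).
  exact: derivable_hornerC.
exact: (@derivableV _ _ (horner (rat_den f) : C^o -> C^o) _ _ d0 (derivable_hornerC _ _)).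
Qed.

End GammaPoints.

(** * Identities between the coefficients *)

Section FractionIdentities.
Local Open Scope ring_scope.

Lemma discriminant_fraction (A : comNzRingType) (F : fieldType) (f : {rmorphism A -> F})
  (S P E : A) : f E != 0 ->
  (2 * (f S / f E)) ^+ 2 - 4 * (f P / f E) = f (4 * (S ^+ 2 - P * E)) / f (E ^+ 2).
Proof.
by move=> E0; rewrite rmorphM rmorphB !rmorphXn [f (P * E)]rmorphM rmorph_nat; field.
Qed.

Lemma pencil_fraction (A : comNzRingType) (F : fieldType) (f : {rmorphism A -> F})
  (S P E o : A) : f E != 0 -> (2 : F) != 0 ->
  (2 * f o * (f P / f E) - 2 * (f S / f E)) / (2 - f o * (2 * (f S / f E))) =
  f (o * P - S) / f (E - o * S).
Proof.
move=> E0 t0; rewrite !rmorphB !rmorphM.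
have -> : 2 * f o * (f P / f E) - 2 * (f S / f E) = (2 / f E) * (f o * f P - f S).
  by field.
have -> : 2 - f o * (2 * (f S / f E)) = (2 / f E) * (f E - f o * f S) by field.
by rewrite -mulf_div divff ?mul1r // mulf_neq0 ?invr_eq0.
Qed.

Lemma scaled_fraction (A : comNzRingType) (F : fieldType) (f : {rmorphism A -> F})
  (x y u : A) : f u != 0 -> f (u * x) / f (u * y) = f x / f y.
Proof. by move=> u0; rewrite !rmorphM -mulf_div divff ?mul1r. Qed.

(** Put [S = 2 p0 c - s0 d]. At a node the relation between the coefficients
    gives [S = - eta E] and [P = - eta S]; each of the two steps from [E] to
    [P] adds [rho] to the logarithmic derivative. *)
Lemma phasar_doubling (A : comNzRingType)
  (z eta rho s0 p0 c d a' b' c' d' : A) :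
  s0 * (eta * c) - 2 * (eta * d) + 2 * p0 * c - s0 * d = 0 ->
  s0 * a' - 2 * b' + 2 * p0 * c' - s0 * d' = 0 ->
  z * (a' - eta * c') = rho * eta * c -> z * (b' - eta * d') = rho * eta * d ->
  let P := - 2 * p0 * (eta * c) + s0 * (eta * d) in
  let P' := - 2 * p0 * a' + s0 * b' in
  let E := s0 * c - 2 * d in let E' := s0 * c' - 2 * d' in
  z * (P' * E - P * E') = 2 * rho * (P * E).
Proof.
move=> h1 h2 h3 h4 P P' E E'.
have SE : 2 * p0 * c - s0 * d = - (eta * E).
  by rewrite -[LHS]subr0 -h1 /E; ring.
have PE : P = eta ^+ 2 * E.
  transitivity (- eta * (2 * p0 * c - s0 * d)); first by rewrite /P; ring.
  by rewrite SE; ring.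
have S' : z * (2 * p0 * c' - s0 * d') = - (eta * (z * E')) - rho * eta * E.
  transitivity (2 * (z * (b' - eta * d')) - s0 * (z * (a' - eta * c')) - eta * (z * E')
    + z * (s0 * a' - 2 * b' + 2 * p0 * c' - s0 * d')); first by rewrite /E'; ring.
  by rewrite h2 h3 h4 /E; ring.
have zP' : z * P' = eta ^+ 2 * (z * E') + 2 * rho * eta ^+ 2 * E.
  transitivity (- 2 * p0 * (z * (a' - eta * c')) + s0 * (z * (b' - eta * d'))
    - eta * (z * (2 * p0 * c' - s0 * d'))); first by rewrite /P'; ring.
  rewrite h3 h4 S'.
  transitivity (eta ^+ 2 * (z * E') + rho * eta ^+ 2 * E - rho * eta * (2 * p0 * c - s0 * d)).
    by ring.
  by rewrite SE; ring.
transitivity (z * P' * E - z * (P * E')); first by ring.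
by rewrite zP' PE; ring.
Qed.

(** Up to the factor [4 / E ^ 2], with [E = s0 c - 2 d], the left-hand side is
    [s ^ 2 - 4 p]: this is why the royal nodes are zeros of the determinant. *)
Lemma royal_discriminant (A : comNzRingType) (s0 p0 a b c d : A) :
  s0 * a - 2 * b + 2 * p0 * c - s0 * d = 0 ->
  (2 * p0 * c - s0 * d) ^+ 2 - (- 2 * p0 * a + s0 * b) * (s0 * c - 2 * d) =
  (s0 ^+ 2 - 4 * p0) * (a * d - b * c).
Proof.
move=> h; transitivity ((2 * p0 * c - s0 * d) * (s0 * a - 2 * b + 2 * p0 * c - s0 * d) +
  (s0 ^+ 2 - 4 * p0) * (a * d - b * c)); first by ring.
by rewrite h mulr0 add0r.
Qed.

End FractionIdentities.

(** * The function [h = (s, p)] *)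

Section Construction.
Local Open Scope ring_scope.
Context {R : realType}.
Local Notation C := R[i].
Implicit Types (z w omega zeta : C).
Context {n k : nat} {Dt : blaschke_data R n k} {a b c d : {poly C}} {s0 p0 : C}.
Hypotheses (hparam : normalised_parametrization Dt a b c d)
  (hp0 : `|p0| = 1) (hs0 : s0 = s0^* * p0) (hs0_lt : `|s0| < 2)
  (hrel : s0 *: a - 2 *: b + (2 * p0) *: c - s0 *: d = 0).

Local Notation W := (param_det a b c d).
Definition sNum : {poly C} := (2 * p0) *: c - s0 *: d.
Definition pNum : {poly C} := (- 2 * p0) *: a + s0 *: b.
Definition hDen : {poly C} := s0 *: c - 2 *: d.
Definition sFun : {fraction {poly C}} := 2 * (FracField.tofrac sNum / FracField.tofrac hDen).
Definition pFun : {fraction {poly C}} := FracField.tofrac pNum / FracField.tofrac hDen.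

Lemma sNumE z : sNum.[z] = 2 * p0 * c.[z] - s0 * d.[z].
Proof. by rewrite /sNum hornerD hornerN !hornerZ. Qed.

Lemma pNumE z : pNum.[z] = - 2 * p0 * a.[z] + s0 * b.[z].
Proof. by rewrite /pNum hornerD !hornerZ. Qed.

Lemma hDenE z : hDen.[z] = s0 * c.[z] - 2 * d.[z].
Proof. by rewrite /hDen hornerD hornerN !hornerZ. Qed.

Lemma hrelE z : s0 * a.[z] - 2 * b.[z] + 2 * p0 * c.[z] - s0 * d.[z] = 0.
Proof.
have := congr1 (fun p : {poly C} => p.[z]) hrel.
by rewrite /= horner0 !hornerD !hornerN !hornerZ.
Qed.

Lemma hrel_deriv z :
  s0 * a^`().[z] - 2 * b^`().[z] + 2 * p0 * c^`().[z] - s0 * d^`().[z] = 0.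
Proof.
have := congr1 (fun p : {poly C} => p^`().[z]) hrel.
by rewrite /= !derivB derivD derivB !derivZ deriv0 horner0 !hornerD !hornerN !hornerZ.
Qed.

Lemma sNum_alt z : sNum.[z] = 2 * b.[z] - s0 * a.[z].
Proof. by rewrite sNumE -[LHS]subr0 -(hrelE z); ring. Qed.

Lemma p0_conj : p0 * p0^* = 1.
Proof. by rewrite -normCK hp0 expr1n. Qed.

Lemma s0_conj : s0^* = s0 * p0^*.
Proof. by rewrite {2}hs0 -mulrA p0_conj mulr1. Qed.

Lemma two_neq0 : (2 : C) != 0. Proof. by rewrite pnatr_eq0. Qed.

(** The conditions on [s0] and [p0] make the passage from [(d, c)] to
    [(hDen, sNum)] an isometry, up to a positive factor, for the indefinite
    form [|x| ^ 2 - |y| ^ 2]. *)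
Lemma hDen_sNum_norm z : `|hDen.[z]| ^+ 2 - `|sNum.[z]| ^+ 2 =
  (4 - `|s0| ^+ 2) * (`|d.[z]| ^+ 2 - `|c.[z]| ^+ 2).
Proof.
rewrite !normCK hDenE sNumE !rmorphB !rmorphM /= !conjC_nat.
move: (c.[z]) (d.[z]) => x y.
rewrite (_ : (s0 * x - 2 * y) * (s0^* * x^* - 2 * y^*) -
  (2 * p0 * x - s0 * y) * (2 * p0^* * x^* - s0^* * y^*) =
  (4 - s0 * s0^*) * (y * y^* - x * x^*) + 4 * (1 - p0 * p0^*) * (x * x^*) +
  2 * (s0^* * p0 - s0) * (x * y^*) + 2 * (s0 * p0^* - s0^*) * (x^* * y)); last by ring.
by rewrite p0_conj -hs0 -s0_conj !subrr; ring.
Qed.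

Lemma sNum_le_hDen {z} : closed_disc z -> `|sNum.[z]| <= `|hDen.[z]|.
Proof.
move=> cz; rewrite -ler_sqr ?nnegrE // -subr_ge0 hDen_sNum_norm mulr_ge0 // subr_ge0.
  rewrite (_ : 4 = 2 ^+ 2); last by ring.
  by rewrite ler_sqr ?nnegrE ?ler0n // ltW.
by rewrite ler_sqr ?nnegrE //; exact: (param_dominated hparam cz).
Qed.

Lemma hDen_neq0 {z} : closed_disc z -> hDen.[z] != 0.
Proof.
move=> cz; rewrite hDenE subr_eq0; apply/eqP => e.
have cd := param_dominated hparam cz.
have d0 : 0 < `|d.[z]|.
  rewrite lt_def normr_ge0 andbT; apply/eqP => d0.
  apply: (param_neq0 hparam cz).
  by split; apply/normr0_eq0 => //; apply/le_anti; rewrite normr_ge0 andbT -d0.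
have : `|s0 * c.[z]| < 2 * `|d.[z]|.
  rewrite normrM; apply: (le_lt_trans (ler_wpM2l (normr_ge0 _) cd)).
  by rewrite ltr_pM2r.
by rewrite e normrM normr_nat ltxx.
Qed.

Lemma hDen_poly_neq0 : hDen != 0.
Proof.
have c0 : closed_disc (0 : C) by rewrite /closed_disc /= normr0 ler01.
by have := hDen_neq0 c0; apply: contra_neq => ->; rewrite horner0.
Qed.

Lemma hDen_frac_neq0 : FracField.tofrac hDen != 0.
Proof. by rewrite tofrac_eq0 hDen_poly_neq0. Qed.

Lemma sFun_ratio : sFun = FracField.tofrac (2%:P * sNum) / FracField.tofrac hDen.
Proof.
by rewrite /sFun tofracM -mulrA; congr (_ * _); rewrite polyC_natr tofracMn tofrac1.
Qed.

Lemma sFun_eval {z} : closed_disc z -> rat_eval sFun z = 2 * sNum.[z] / hDen.[z].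
Proof. by move=> cz; rewrite sFun_ratio rat_evalE ?hDen_neq0 // hornerM hornerC. Qed.

Lemma pFun_eval {z} : closed_disc z -> rat_eval pFun z = pNum.[z] / hDen.[z].
Proof. by move=> cz; rewrite rat_evalE ?hDen_neq0. Qed.

(** The value [Phi_omega (s0, p0)]. It is the parameter of the solution
    [Phi_omega \o h]. *)
Definition pencil_param omega := (s0 - 2 * omega * p0) / (omega * s0 - 2).

Lemma pencil_den_neq0 {omega} : circle omega -> omega * s0 - 2 != 0.
Proof.
rewrite /circle /= => co; rewrite subr_eq0; apply/eqP => e.
have s2 : `|s0| = 2 by rewrite -[RHS](normr_nat C 2) -e normrM co mul1r.
by have := hs0_lt; rewrite s2 ltxx.
Qed.

Lemma pencil_param_circle {omega} : circle omega -> circle (pencil_param omega).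
Proof.
move=> co; have den := pencil_den_neq0 co.
rewrite /circle /= /pencil_param normrM normfV.
suff -> : `|s0 - 2 * omega * p0| = `|omega * s0 - 2| by rewrite divff // normr_eq0.
have -> : s0 - 2 * omega * p0 = omega * p0 * (omega * s0 - 2)^*.
  rewrite rmorphB rmorphM /= conjC_nat mulrBr.
  transitivity ((omega * omega^*) * (s0^* * p0) - 2 * omega * p0); last by ring.
  by rewrite -hs0 -normCK co expr1n mul1r.
by rewrite !normrM co hp0 norm_conjC !mul1r.
Qed.

Lemma pencil_paramK {omega} : circle omega ->
  pencil_param omega * (omega * s0 - 2) = s0 - 2 * omega * p0.
Proof. by move=> co; rewrite /pencil_param divfK ?pencil_den_neq0. Qed.

Lemma pencil_num {omega} z : circle omega -> omega * pNum.[z] - sNum.[z] =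
  (omega * s0 - 2) * (pencil_param omega * a.[z] + b.[z]).
Proof.
move=> /pencil_paramK e; rewrite mulrDr mulrCA mulrA e sNum_alt pNumE; ring.
Qed.

Lemma pencil_den {omega} z : circle omega -> hDen.[z] - omega * sNum.[z] =
  (omega * s0 - 2) * (pencil_param omega * c.[z] + d.[z]).
Proof.
move=> /pencil_paramK e; rewrite mulrDr mulrCA mulrA e sNumE hDenE; ring.
Qed.

Lemma Phi_comp_pencil {omega} : circle omega ->
  Phi_comp omega (sFun, pFun) = lin_frac a b c d (pencil_param omega).
Proof.
move=> co; rewrite /Phi_comp /= /constf /sFun /pFun.
have two0 : (2 : {fraction {poly C}}) != 0.
  have := two_neq0; rewrite -(inj_eq (@polyC_inj C)) polyC_natr polyC0 -tofrac_eq0.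
  by rewrite tofracMn tofrac1.
rewrite (pencil_fraction _ _ (@FracField.tofrac {poly C}) _ _ _ omega%:P hDen_frac_neq0 two0).
have -> : omega%:P * pNum - sNum = (omega * s0 - 2)%:P * (pencil_param omega *: a + b).
  apply: (circle_poly_eq [::]) => z _ _.
  by rewrite hornerD hornerN !hornerM !hornerC pencil_num // hornerD hornerZ.
have -> : hDen - omega%:P * sNum = (omega * s0 - 2)%:P * (pencil_param omega *: c + d).
  apply: (circle_poly_eq [::]) => z _ _.
  by rewrite hornerD hornerN !hornerM !hornerC pencil_den // hornerD hornerZ.
have u0 : FracField.tofrac (omega * s0 - 2)%:P != 0.
  by rewrite tofrac_eq0 polyC_eq0 pencil_den_neq0.
exact: (scaled_fraction _ _ (@FracField.tofrac {poly C}) (pencil_param omega *: a + b)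
  (pencil_param omega *: c + d) _ u0).
Qed.

(** The map from [omega] to the parameter of the pencil is invertible, so only
    finitely many [omega] meet an exceptional parameter. *)
Lemma Phi_comp_solution : finite_set [set omega | circle omega /\
  ~ blaschke_solution Dt (Phi_comp omega (sFun, pFun))].
Proof.
have [s sP] := generic_solution hparam.
apply: (sub_finite_set (B := [set` [seq (s0 + 2 * zeta) / (2 * p0 + zeta * s0) | zeta <- s]]));
  last exact: finite_seq.
move=> omega [co nsol] /=; apply/mapP; exists (pencil_param omega).
  apply: contrapT => /negP zs; apply: nsol; rewrite Phi_comp_pencil //.
  by apply: sP zs; exact: pencil_param_circle.
set zeta := pencil_param omega.
have cz : circle zeta by exact: pencil_param_circle.
have e : zeta * (omega * s0 - 2) = s0 - 2 * omega * p0.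
  exact: pencil_paramK.
have nz : 2 * p0 + zeta * s0 != 0.
  rewrite addr_eq0; apply/eqP => e2.
  have s2 : `|s0| = 2.
    by rewrite -[LHS]mul1r -{1}cz -normrM -normrN -e2 normrM hp0 mulr1 normr_nat.
  by have := hs0_lt; rewrite s2 ltxx.
apply: (mulIf nz); rewrite divfK //.
transitivity (zeta * (omega * s0 - 2) + 2 * omega * p0 + 2 * zeta); first by ring.
by rewrite e; ring.
Qed.

(** Reversal sends [c] to [b] and [d] to [a], so it sends [hDen] to a multiple
    of [pNum], and [sNum] to a multiple of itself by [sNum_alt]. *)
Lemma pNum_hDen_circle {z} : circle z -> exists2 u : C, u != 0 &
  [/\ u * pNum.[z] = z ^+ n * p0 * (hDen.[z])^*,
      u * sNum.[z] = z ^+ n * p0 * (sNum.[z])^* & `|u| = 1].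
Proof.
move=> cz; have [tau [ct _ _ rv]] := param_reversal hparam.
have [e1 e2] := rv z cz.
exists (tau ^+ n); first by rewrite expf_neq0 ?circle_neq0.
split; last by rewrite normrX ct expr1n.
- rewrite pNumE hDenE rmorphB !rmorphM /= conjC_nat.
  transitivity (s0^* * p0 * (z ^+ n * (c.[z])^*) -
    2 * p0 * (z ^+ n * (d.[z])^*)); last by ring.
  by rewrite e1 e2 -hs0; ring.
rewrite [in LHS]sNum_alt sNumE rmorphB !rmorphM /= conjC_nat.
transitivity (2 * (p0 * p0^*) * (z ^+ n * (c.[z])^*) -
  s0^* * p0 * (z ^+ n * (d.[z])^*)); last by ring.
by rewrite e1 e2 -hs0 p0_conj; ring.
Qed.

Lemma pFun_circle {z} : circle z -> `|pNum.[z]| = `|hDen.[z]|.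
Proof.
move=> cz; have [u u0 [/(congr1 (fun x => `|x|)) + _ u1]] := pNum_hDen_circle cz.
by rewrite !normrM normrX cz hp0 u1 expr1n norm_conjC !mul1r.
Qed.

Lemma sFun_le2 {z} : closed_disc z -> `|2 * sNum.[z] / hDen.[z]| <= 2.
Proof.
move=> cz; rewrite !normrM normfV normr_nat ler_pdivrMr ?normr_gt0 ?hDen_neq0 //.
by rewrite ler_pM2l ?ltr0n // sNum_le_hDen.
Qed.

Lemma h_Gamma {z} : closed_disc z -> Gamma (2 * sNum.[z] / hDen.[z], pNum.[z] / hDen.[z]).
Proof.
move=> cz; apply: Gamma_of_pencil (sFun_le2 cz) _ => omega co.
have E0 := hDen_neq0 cz.
have -> : 2 * omega * (pNum.[z] / hDen.[z]) - 2 * sNum.[z] / hDen.[z] =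
  2 / hDen.[z] * (omega * pNum.[z] - sNum.[z]) by field.
have -> : 2 - omega * (2 * sNum.[z] / hDen.[z]) = 2 / hDen.[z] * (hDen.[z] - omega * sNum.[z]).
  by field.
rewrite pencil_num // pencil_den // [leLHS]normrM [leRHS]normrM.
apply: ler_wpM2l; first exact: normr_ge0.
rewrite [leLHS]normrM [leRHS]normrM; apply: ler_wpM2l; first exact: normr_ge0.
exact: (param_le hparam (pencil_param_circle co) cz).
Qed.

Lemma h_bGamma {z} : circle z -> bGamma (2 * sNum.[z] / hDen.[z], pNum.[z] / hDen.[z]).
Proof.
move=> cz; have cdz := circle_closed_disc cz; have E0 := hDen_neq0 cdz.
apply: bGamma_of_bounds; first exact: sFun_le2.
  have [u u0 [eP eS _]] := pNum_hDen_circle cz.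
  have E0' : (hDen.[z])^* != 0 by rewrite conjC_eq0.
  rewrite rmorphM rmorphM /= conjC_nat fmorphV /=.
  move: E0 E0' eP eS; move: ((hDen.[z])^*) ((sNum.[z])^*) => E' S'.
  move: (hDen.[z]) (sNum.[z]) (pNum.[z]) (z ^+ n) => E S P v E0 E0' eP eS.
  apply: (mulfI u0).
  transitivity (2 * (u * S) / E); first by field.
  transitivity (2 * S' / E' * (u * P) / E); last by field; rewrite E0 E0'.
  by rewrite eP eS; field; rewrite E0 E0'.
by rewrite normrM normfV pFun_circle // divff // normr_eq0.
Qed.

Lemma h_Gamma_inner : rational_Gamma_inner (sFun, pFun).
Proof.
split.
- have nz z : disc z -> hDen.[z] != 0 by move=> dz; apply: hDen_neq0; exact: ltW.
  split; last exact: holomorphic_ratio.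
  have -> : fst \o rat_map (sFun, pFun) = rat_eval sFun by [].
  by rewrite sFun_ratio; exact: holomorphic_ratio.
- move=> z dz; have cz : closed_disc z by exact: ltW.
  by rewrite /rat_map /= sFun_eval // pFun_eval //; exact: h_Gamma.
apply: aeW => t; have ct := circle_norm_expi (t : R).
have E0 := hDen_neq0 (circle_closed_disc ct).
exists (2 * sNum.[expi t] / hDen.[expi t], pNum.[expi t] / hDen.[expi t]); split.
- have -> : fst \o rat_map (sFun, pFun) = rat_eval sFun by [].
  rewrite sFun_ratio /=.
  have -> : 2 * sNum.[expi t] = (2%:P * sNum).[expi t] by rewrite hornerM hornerC.
  exact: ratio_radial.
- exact: ratio_radial.
exact: h_bGamma.
Qed.

Lemma disc0_neq0 : s0 ^+ 2 - 4 * p0 != 0.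
Proof.
rewrite subr_eq0; apply/eqP => /(congr1 (fun x => `|x|)).
rewrite normrX normrM hp0 mulr1 normr_nat => e.
have : `|s0| ^+ 2 < 2 ^+ 2 by rewrite ltr_pXn2r ?nnegrE ?ler0n.
by rewrite e expr2 -natrM ltxx.
Qed.

Lemma h_discriminant z :
  sNum.[z] ^+ 2 - pNum.[z] * hDen.[z] = (s0 ^+ 2 - 4 * p0) * W.[z].
Proof.
rewrite sNumE pNumE hDenE (royal_discriminant _ _ _ _ _ _ _ (hrelE z)).
by rewrite /param_det hornerD hornerN !hornerM.
Qed.

Lemma h_royal {z} : closed_disc z ->
  royal_variety (rat_map (sFun, pFun) z) <-> z \in nodes Dt.
Proof.
move=> cz; rewrite -(det_root hparam cz) /rat_map /= sFun_eval // pFun_eval //.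
have E0 := hDen_neq0 cz.
have key : (2 * sNum.[z] / hDen.[z]) ^+ 2 - 4 * (pNum.[z] / hDen.[z]) =
    4 / hDen.[z] ^+ 2 * (s0 ^+ 2 - 4 * p0) * W.[z].
  by rewrite -[RHS]mulrA -h_discriminant; field.
have nz : 4 / hDen.[z] ^+ 2 * (s0 ^+ 2 - 4 * p0) != 0.
  by rewrite !mulf_neq0 ?invr_eq0 ?expf_neq0 ?disc0_neq0 ?pnatr_eq0.
split=> [/royalP e|/eqP W0].
  have /eqP : 4 / hDen.[z] ^+ 2 * (s0 ^+ 2 - 4 * p0) * W.[z] = 0 by rewrite -key e subrr.
  by rewrite mulf_eq0 (negPf nz).
by apply/royalP/eqP; rewrite -subr_eq0 key W0 mulr0.
Qed.

Lemma h_zero_order {z} : closed_disc z ->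
  zero_order (sFun ^+ 2 - 4 * pFun) z = mup z W.
Proof.
move=> cz; rewrite /sFun /pFun.
rewrite (discriminant_fraction _ _ (@FracField.tofrac {poly C}) _ _ _ hDen_frac_neq0).
rewrite zero_orderE; last by rewrite horner_exp expf_neq0 // hDen_neq0.
have -> : 4 * (sNum ^+ 2 - pNum * hDen) = (4 * (s0 ^+ 2 - 4 * p0))%:P * W.
  apply: (circle_poly_eq [::]) => w _ _.
  have four : (4 : {poly C}).[w] = 4 by rewrite -polyC_natr hornerC.
  rewrite [LHS]hornerM [RHS]hornerM four hornerC -mulrA -h_discriminant.
  by rewrite [in LHS]hornerD hornerN horner_exp hornerM.
by rewrite mupMr // rootC mulf_neq0 ?pnatr_eq0 ?disc0_neq0.
Qed.

(** The zeros on the circle are double, but count half there. *)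
Lemma h_multiplicity j : royal_multiplicity (sFun, pFun) (node Dt j) = 1.
Proof.
rewrite /royal_multiplicity /= h_zero_order; last exact: node_closed_disc.
rewrite (mup_det hparam); have [jk|kj] := ltnP j k.
  have [/= -> _] := node_circle Dt jk.
  by rewrite ltxx /= divff // pnatr_eq0.
by have [/= -> _] := node_disc Dt kj.
Qed.

Lemma sum_multiplicity (s : seq C) : uniq s -> {subset s <= nodes Dt} ->
  \sum_(z \in [set` s]) royal_multiplicity (sFun, pFun) z = (size s)%:R.
Proof.
move=> us sub; rewrite -fsbig_seq //.
transitivity (\sum_(z <- s) (1 : rat)).
  by apply: eq_big_seq => z /sub/nodesP[j ->]; exact: h_multiplicity.
by rewrite big_const_seq count_predT -Monoid.iteropE.
Qed.

Lemma royal_nodesE : royal_nodes (sFun, pFun) = [set` nodes Dt].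
Proof.
apply/seteqP; split=> z /=; first by move=> [cz /(h_royal cz)].
move=> zn; have cz : closed_disc z by have [j ->] := nodesP zn; exact: node_closed_disc.
by split=> //; apply/h_royal.
Qed.

Lemma royal_nodes_circleE :
  royal_nodes (sFun, pFun) `&` circle (R := R) = [set` take k (nodes Dt)].
Proof.
rewrite royal_nodesE; apply/seteqP; split=> z /=.
  move=> [/nodesP[j ->] cz]; rewrite mem_take_nodes ltnNge; apply/negP => kj.
  by have [dj _] := node_disc Dt kj; move: dj; rewrite /disc /= cz ltxx.
move=> zk; have zn := mem_take zk; split=> //.
have [j zE] := nodesP zn; rewrite zE mem_take_nodes in zk *.
by have [] := node_circle Dt zk.
Qed.

Lemma h_royal_class : royal_class n k (sFun, pFun).
Proof.
have sn : size (nodes Dt) = n by rewrite size_map size_enum_ord.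
split; first exact: h_Gamma_inner.
(* The determinant has finitely many zeros, so one of the points of modulus
   [1 / 2] is not a zero. *)
- move=> sub; have [s sP] := poly_roots (det_neq0 hparam).
  have [x cx xs] := circle_avoid [seq 2 * y | y <- s].
  have dx : disc (x / 2).
    by rewrite /disc /= normrM normfV cx normr_nat mul1r invf_lt1 ?ltr0n ?ltr1n.
  have cdx : closed_disc (x / 2) by exact: ltW.
  have /(h_royal cdx) : royal_variety (rat_map (sFun, pFun) (x / 2)).
    by apply: sub; exists (x / 2).
  rewrite -(det_root hparam cdx) -rootE sP => xin.
  move/negP: xs; apply; apply/mapP; exists (x / 2) => //.
  by rewrite mulrC divfK ?two_neq0.
- by rewrite royal_nodesE sum_multiplicity ?uniq_nodes // sn.
rewrite royal_nodes_circleE sum_multiplicity ?take_uniq ?uniq_nodes //.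
  by rewrite size_takel // sn; exact: blaschke_data_le Dt.
by move=> z /mem_take.
Qed.

Lemma h_interpolation j :
  rat_map (sFun, pFun) (node Dt j) = (- 2 * target Dt j, target Dt j ^+ 2).
Proof.
have cz := node_closed_disc (Dt := Dt) j; have E0 := hDen_neq0 cz.
rewrite /rat_map /= sFun_eval // pFun_eval //.
have [az bz] := param_interpolation hparam j.
have SE : sNum.[node Dt j] = - (target Dt j * hDen.[node Dt j]).
  by rewrite sNum_alt hDenE az bz; ring.
have PE : pNum.[node Dt j] = target Dt j ^+ 2 * hDen.[node Dt j].
  transitivity (- target Dt j * sNum.[node Dt j]); first by rewrite sNumE pNumE az bz; ring.
  by rewrite SE; ring.
by rewrite SE PE; congr pair; field.
Qed.

Lemma pFun_phasar (j : 'I_k) :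
  is_phasar_derivative (rat_eval pFun) (bnode Dt j) (2 * phasar Dt j).
Proof.
have cz := bnode_circle (Dt := Dt) j; have E0 := hDen_neq0 (circle_closed_disc cz).
apply: phasar_ratio => //.
  by rewrite -normr_eq0 pFun_circle // normr_eq0.
have [az bz] := param_interpolation hparam (widen_ord (blaschke_data_le Dt) j).
have [h3 h4] := param_phasar hparam j.
rewrite -/(bnode Dt j) in az bz.
have h1 := hrelE (bnode Dt j); have h2 := hrel_deriv (bnode Dt j).
rewrite az bz in h1.
have dP : pNum^`().[bnode Dt j] = - 2 * p0 * a^`().[bnode Dt j] + s0 * b^`().[bnode Dt j].
  by rewrite /pNum derivD !derivZ hornerD !hornerZ.
have dE : hDen^`().[bnode Dt j] = s0 * c^`().[bnode Dt j] - 2 * d^`().[bnode Dt j].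
  by rewrite /hDen derivB !derivZ hornerD hornerN !hornerZ.
rewrite dP dE pNumE hDenE az bz rmorphM rmorph_nat.
exact: phasar_doubling h1 h2 h3 h4.
Qed.

End Construction.

Arguments sFun {R} c d s0 p0.
Arguments pFun {R} a b c d s0 p0.

Theorem theorem4p8 (R : realType) (n k : nat) (D : blaschke_data R n k)
    (a b c d : {poly R[i]}) (s0 p0 : R[i])
    (hsolvable : exists phi, blaschke_solution D phi)
    (hparam : normalised_parametrization D a b c d)
    (hp0 : `|p0| = 1)
    (hs0 : s0 = s0^* * p0)
    (hs0_lt : `|s0| < 2)
    (hrel : s0 *: a - 2 *: b + (2 * p0) *: c - s0 *: d = 0) :
  exists s p : {fraction {poly R[i]}},
    [/\ s = 2 * (FracField.tofrac ((2 * p0) *: c - s0 *: d)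
                 / FracField.tofrac (s0 *: c - 2 *: d)),
        p = FracField.tofrac ((- 2 * p0) *: a + s0 *: b)
            / FracField.tofrac (s0 *: c - 2 *: d) &
        rational_Gamma_inner (s, p) /\
        [/\ royal_class n k (s, p),
            forall j : 'I_n,
              rat_map (s, p) (node D j) = (- 2 * target D j, target D j ^+ 2),
            forall j : 'I_k,
              is_phasar_derivative (rat_eval p) (bnode D j) (2 * phasar D j) &
            finite_set [set omega | circle omega /\
              ~ blaschke_solution D (Phi_comp omega (s, p))]]].
Proof.
exists (sFun c d s0 p0), (pFun a b c d s0 p0).
split; [by []|by []|split; first exact: (h_Gamma_inner hparam)].
split.
- exact: (h_royal_class hparam).
- exact: (h_interpolation hparam).
- exact: (pFun_phasar hparam).
exact: (Phi_comp_solution hparam).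
Qed.
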